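(* Let $\mu\ge 1$, let $(t_1,\dots,t_\mu)\in\mathbb{C}^\mu$ be a generic parameter, and let $\tilde f_q(x,q)=x^{\mu+1}+\sum_{i=1}^{\mu}t_i x^{\mu-i}q^{i+1}\in S=\mathbb{C}[x,q]$. Then the functor $\tau^{\mu-1}$ is the Serre functor on $\mathrm{HMF}^{gr}_S(\tilde f_q)$.
   Context: Generic parameter. The complex numbers $s_1,\dots,s_{\mu+1}$ (unique up to permutation, with $\sum_i s_i=0$) are determined by $t_i=I_{i+1}(s_1,\dots,s_{\mu+1})$ for $i=1,\dots,\mu$, where $I_k$ is the elementary symmetric polynomial of degree $k$; equivalently $\tilde f_q=\prod_{i=1}^{\mu+1}(x+s_iq)$. The parameter is called generic if $s_i\neq s_j$ for all $i\ne j$. Grading. Put $h:=\mu+1$. $S=\mathbb{C}[x,q]$ is $(2\mathbb{Z}/h)$-graded with $\deg x=\deg q=2/h$, so $\tilde f_q$ has degree $2$. Graded $S$-modules are $(2\mathbb{Z}/h)$-graded, and $\tau$ is the degree shift $(\tau M)_s=M_{s+2/h}$; graded free modules of finite rank are finite direct sums of modules $\tau^nS$, $n\in\mathbb{Z}$. The category $\mathrm{HMF}^{gr}_S(f)$ (for $f=\tilde f_q$). Objects are graded matrix factorizations $\overline F=(F_0\overset{f_0}{\underset{f_1}{\rightleftarrows}}F_1)$: $F_0,F_1$ are graded free $S$-modules of finite rank, $f_0:F_0\to F_1$ is a graded $S$-homomorphism of degree $0$, $f_1:F_1\to F_0$ is a graded $S$-homomorphism of degree $2$, and $f_1f_0=f\cdot\mathrm{id}_{F_0}$,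 $f_0f_1=f\cdot\mathrm{id}_{F_1}$. Morphisms $\overline F\to\overline{F'}$ are pairs $(\phi_0:F_0\to F_0',\ \phi_1:F_1\to F_1')$ of degree-$0$ graded homomorphisms with $\phi_1f_0=f_0'\phi_0$ and $\phi_0f_1=f_1'\phi_1$, modulo the pairs of the form $(h_1f_0+f_1'h_0,\ f_0'h_1+h_0f_1)$ with $h_0:F_0\to F_1'$ graded of degree $-2$ and $h_1:F_1\to F_0'$ graded of degree $0$. The shift $\tau$ acts on objects and morphisms componentwise and is an auto-equivalence. The translation functor is $T\overline F=(F_1\overset{-f_1}{\underset{-\tau^h(f_0)}{\rightleftarrows}}\tau^hF_0)$ on objects and $T(\phi_0,\phi_1)=(\phi_1,\tau^h(\phi_0))$ on morphisms. The mapping cone of $\Phi=(\phi_0,\phi_1)$ is $$C(\Phi)=\left(F_1\oplus F_0'\overset{c_0}{\underset{c_1}{\rightleftarrows}}\tau^hF_0\oplus F_1'\right),\quad c_0=\begin{pmatrix}-f_1&0\\ \phi_1&f_0'\end{pmatrix},\quad c_1=\begin{pmatrix}-\tau^h(f_0)&0\\ \tau^h(\phi_0)&f_1'\end{pmatrix},$$ and the exact triangles are those isomorphic to $\overline F\xrightarrow{\Phi}\overline{F'}\to C(\Phi)\to T\overline F$ with the maps ${}^t(0\ \mathrm{id})$ and $(-\mathrm{id}\ 0)$. With these data $\mathrm{HMF}^{gr}_S(f)$ is a $\mathbb{C}$-linear triangulated category. Serre functor is meant in the sense of Bondal–Kapranov: an auto-equivalence $\mathcal{S}$ with isomorphisms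 $\mathrm{Hom}(M,N)\cong\mathrm{Hom}(N,\mathcal{S}M)^*$ (dual over $\mathbb{C}$), natural in $M$ and $N$. *)

(* Defs.v *)
From HB Require Import structures.
From mathcomp Require Import all_boot all_order all_algebra.
From mathcomp Require Import generic_quotient ring_quotient.
From mathcomp Require Import boolp reals complex mpoly.

Set Implicit Arguments.
Unset Strict Implicit.
Unset Printing Implicit Defensive.

Import Order.TTheory GRing.Theory Num.Theory.
Local Open Scope ring_scope.
Local Open Scope quotient_scope.

Section QuotientModule.
Variables (k : pzRingType) (V : lmodType k) (I : submodClosed V).

(* submodClosed does not inherit zmodClosed, which Quotient.quot needs. *)
Definition subzmod : {pred V} := fun v => v \in I.
Lemma subzmod_closed : zmod_closed subzmod.
Proof.
split=> [|u v uI vI]; first exact: (rpred0 I).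
by apply: (rpredD (S := I)) uI _; rewrite -scaleN1r; exact: rpredZ vI.
Qed.
HB.instance Definition _ := GRing.isZmodClosed.Build V subzmod subzmod_closed.

Definition lquot : Type := Quotient.quot subzmod.
HB.instance Definition _ := GRing.Zmodule.on lquot.

Definition lpi (v : V) : lquot := \pi_(Quotient.quot subzmod) v.
Definition lrepr (x : lquot) : V := repr (x : Quotient.quot subzmod).

Lemma lreprK x : lpi (lrepr x) = x.
Proof. exact: reprK. Qed.

Lemma lpi_eq u v : (lpi u = lpi v) <-> (u - v \in I).
Proof. by rewrite (Quotient.idealrBE subzmod); split=> /eqP. Qed.

Lemma lpiD u v : lpi (u + v) = lpi u + lpi v.
Proof. exact: (raddfD (\pi_(Quotient.quot subzmod))). Qed.

Definition lscale (a : k) (x : lquot) : lquot := lpi (a *: lrepr x).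

Lemma lpiZ a v : lpi (a *: v) = lscale a (lpi v).
Proof.
apply/lpi_eq; rewrite -scalerBr; apply: rpredZ.
by apply/lpi_eq; rewrite lreprK.
Qed.

Lemma lscaleA a b x : lscale a (lscale b x) = lscale (a * b) x.
Proof. by rewrite -[x]lreprK -!lpiZ scalerA. Qed.
Lemma lscale1 : left_id 1 lscale.
Proof. by move=> x; rewrite -[x]lreprK -lpiZ scale1r. Qed.
Lemma lscaleDr : right_distributive lscale +%R.
Proof.
by move=> a x y; rewrite -[x]lreprK -[y]lreprK -!lpiZ -!lpiD -lpiZ scalerDr.
Qed.
Lemma lscaleDl x : {morph lscale^~ x : a b / a + b}.
Proof. by move=> a b; rewrite -[x]lreprK -!lpiZ -!lpiD scalerDl. Qed.

HB.instance Definition _ :=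
  GRing.Zmodule_isLmodule.Build k lquot lscaleA lscale1 lscaleDr lscaleDl.

Lemma lpi_linear : linear lpi.
Proof. by move=> a u v; rewrite lpiD lpiZ. Qed.

End QuotientModule.

Section LinearCategories.
Variable k : fieldType.

Record lincat := LinCat {
  obj :> Type;
  hom : obj -> obj -> lmodType k;
  idm : forall A, hom A A;
  comp : forall A B C, hom B C -> hom A B -> hom A C;
  compA : forall A B C D (f : hom C D) (g : hom B C) (h : hom A B),
    comp f (comp g h) = comp (comp f g) h;
  comp1m : forall A B (f : hom A B), comp (idm B) f = f;
  compm1 : forall A B (f : hom A B), comp f (idm A) = f;
  comp_linearl : forall A B C (g : hom A B),
    linear (fun f : hom B C => comp f g);
  comp_linearr : forall A B C (f : hom B C),
    linear (fun g : hom A B => comp f g)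
}.

Record linfunctor (A B : lincat) := LinFunctor {
  fobj :> A -> B;
  fmap : forall X Y, hom X Y -> hom (fobj X) (fobj Y);
  fmap1 : forall X, fmap (idm X) = idm (fobj X);
  fmap_comp : forall X Y Z (f : hom Y Z) (g : hom X Y),
    fmap (comp f g) = comp (fmap f) (fmap g);
  fmap_linear : forall X Y, linear (@fmap X Y)
}.

Definition idfun_lin (A : lincat) : linfunctor A A :=
  @LinFunctor A A id (fun X Y f => f) (fun=> erefl) (fun _ _ _ _ _ => erefl)
    (fun X Y a u v => erefl).

Section Composition.
Variables (A B C : lincat) (G : linfunctor B C) (F : linfunctor A B).
Let gf X Y (f : hom X Y) := fmap G (fmap F f).
Lemma fcomp_1 X : gf (idm X) = idm (G (F X)).
Proof. by rewrite /gf !fmap1. Qed.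
Lemma fcomp_comp X Y Z (f : hom Y Z) (g : hom X Y) :
  gf (comp f g) = comp (gf f) (gf g).
Proof. by rewrite /gf !fmap_comp. Qed.
Lemma fcomp_linear X Y : linear (@gf X Y).
Proof. by move=> a u v; rewrite /gf !fmap_linear. Qed.
Definition fcomp : linfunctor A C := LinFunctor fcomp_1 fcomp_comp fcomp_linear.
End Composition.

Fixpoint fpow (A : lincat) (F : linfunctor A A) (n : nat) : linfunctor A A :=
  if n is m.+1 then fcomp F (fpow F m) else idfun_lin A.

Definition is_iso (A : lincat) (X Y : A) (f : hom X Y) : Prop :=
  exists g : hom Y X, comp g f = idm X /\ comp f g = idm Y.

Definition nat_isomorphic (A B : lincat) (F G : linfunctor A B) : Prop :=
  exists eta : forall X, hom (F X) (G X),
    (forall X, is_iso (eta X)) /\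
    (forall X Y (f : hom X Y), comp (eta Y) (fmap F f) = comp (fmap G f) (eta X)).

Definition is_equivalence (A B : lincat) (F : linfunctor A B) : Prop :=
  exists G : linfunctor B A,
    nat_isomorphic (fcomp G F) (idfun_lin A) /\
    nat_isomorphic (fcomp F G) (idfun_lin B).

Definition dual (V : lmodType k) : Type := {linear V -> k^o}.

Definition is_dual_iso (V W : lmodType k) (Phi : V -> dual W) : Prop :=
  [/\ (forall a u v w, Phi (a *: u + v) w = a * Phi u w + Phi v w),
      (forall u v, Phi u =1 Phi v -> u = v)
    & (forall xi : dual W, exists v, Phi v =1 xi)].

(* Naturality: for u : M' -> M and v : N -> N', the square relating
   f |-> v f u on Hom(M, N) to xi |-> xi (S u o - o v) on Hom(N, S M)^*. *)
Definition is_serre_functor (A : lincat) (S : linfunctor A A) : Prop :=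
  is_equivalence S /\
  exists Phi : forall M N : A, hom M N -> dual (hom N (S M)),
    (forall M N, is_dual_iso (@Phi M N)) /\
    (forall (M M' N N' : A) (u : hom M' M) (v : hom N N')
            (f : hom M N) (w : hom N' (S M')),
       Phi M' N' (comp v (comp f u)) w = Phi M N f (comp (fmap S u) (comp w v))).

End LinearCategories.

(* The grading group 2Z/h is identified with Z by 2d/h <-> d; thus x and q have
   degree 1, and a map of degree 2 is one of degree h here. *)
Section GradedModules.
Variable k : fieldType.
Local Notation S := {mpoly k[2]}.

Definition in_degree (d : int) (p : S) : bool :=
  if d is Posz n then p \is n.-homog else p == 0.

(* GFree n a is the direct sum of the tau^(a i) S for i < n, where
   (tau^a S)_s = S_(s + a); its underlying module is S^n (column vectors). *)
Record gfree := GFree { grank : nat; gtwist : 'I_grank -> int }.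

Definition ghomog (M : gfree) (s : int) (v : 'cV[S]_(grank M)) : Prop :=
  forall i, in_degree (s + gtwist i) (v i 0).

Definition gshift (M : gfree) : gfree := GFree (fun i => @gtwist M i + 1).

Definition ghom (M N : gfree) (d : int) (A : 'M[S]_(grank N, grank M)) : Prop :=
  forall s v, @ghomog M s v -> @ghomog N (s + d) (A *m v).

Lemma in_degree0 d : in_degree d 0.
Proof. by case: d => n /=; rewrite ?eqxx ?rpred0. Qed.

Lemma in_degreeDZ d c p q :
  in_degree d p -> in_degree d q -> in_degree d (c%:MP * p + q).
Proof.
case: d => n /=; last by move=> /eqP-> /eqP->; rewrite mulr0 addr0.
by move=> hp hq; rewrite mul_mpolyC rpredD ?rpredZ.
Qed.

Lemma ghomog0 M s : @ghomog M s 0.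
Proof. by move=> i; rewrite mxE in_degree0. Qed.

Lemma ghomogDZ M s c u v :
  @ghomog M s u -> @ghomog M s v -> @ghomog M s (c%:MP *: u + v).
Proof. by move=> hu hv i; rewrite !mxE in_degreeDZ. Qed.

Lemma ghom0 M N d : @ghom M N d 0.
Proof. by move=> s v _; rewrite mul0mx; apply: ghomog0. Qed.

Lemma ghom1 M : @ghom M M 0 1%:M.
Proof. by move=> s v; rewrite mul1mx addr0. Qed.

Lemma ghomDZ M N d c A B :
  @ghom M N d A -> @ghom M N d B -> @ghom M N d (c%:MP *: A + B).
Proof.
move=> hA hB s v hv; rewrite mulmxDl -scalemxAl.
by apply: ghomogDZ; [apply: hA | apply: hB].
Qed.

Lemma ghomM M N P d e A B :
  @ghom N P d A -> @ghom M N e B -> @ghom M P (e + d) (A *m B).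
Proof. by move=> hA hB s v hv; rewrite -mulmxA addrA; apply/hA/hB. Qed.

Lemma ghom_shift M N d A : @ghom M N d A -> @ghom (gshift M) (gshift N) d A.
Proof.
have E (P : gfree) s v : @ghomog (gshift P) s v <-> @ghomog P (s + 1) v.
  have H (i : 'I_(grank P)) : s + (gtwist i + 1) = s + 1 + gtwist i.
    by rewrite addrA addrAC.
  by split=> hv i; move: (hv i); rewrite /= H.
by move=> hA s v /E hv; apply/E; rewrite addrAC; apply: hA.
Qed.

End GradedModules.

Arguments ghom {k} M N d A.

Section MatrixFactorizations.
Variables (k : fieldType) (h : nat) (f : {mpoly k[2]}).
Local Notation S := {mpoly k[2]}.

Record gmf := GMF {
  mf0 : gfree;
  mf1 : gfree;
  d0 : 'M[S]_(grank mf1, grank mf0);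
  d1 : 'M[S]_(grank mf0, grank mf1);
  d0_graded : ghom mf0 mf1 0 d0;
  d1_graded : ghom mf1 mf0 h%:Z d1;
  d1d0 : d1 *m d0 = f%:M;
  d0d1 : d0 *m d1 = f%:M
}.

Definition premor (F G : gmf) : Type :=
  ('M[S]_(grank (mf0 G), grank (mf0 F)) *
   'M[S]_(grank (mf1 G), grank (mf1 F)))%type.
HB.instance Definition _ F G := GRing.Zmodule.on (premor F G).

Section PremorModule.
Variables F G : gmf.
Definition pscale (c : k) (p : premor F G) : premor F G :=
  (c%:MP *: p.1, c%:MP *: p.2).
Lemma pscaleA a b x : pscale a (pscale b x) = pscale (a * b) x.
Proof. by rewrite /pscale /= !scalerA -!mpolyCM. Qed.
Lemma pscale1 : left_id 1 pscale.
Proof. by case=> u v; rewrite /pscale /= !scale1r. Qed.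
Lemma pscaleDr : right_distributive pscale +%R.
Proof. by move=> a x y; rewrite /pscale /= !scalerDr. Qed.
Lemma pscaleDl x : {morph pscale^~ x : a b / a + b}.
Proof. by move=> a b; rewrite /pscale /= !mpolyCD !scalerDl. Qed.
HB.instance Definition _ :=
  GRing.Zmodule_isLmodule.Build k (premor F G) pscaleA pscale1 pscaleDr pscaleDl.
End PremorModule.

Definition mf_mor (F G : gmf) : {pred premor F G} := fun p =>
  `[< [/\ ghom (mf0 F) (mf0 G) 0 p.1, ghom (mf1 F) (mf1 G) 0 p.2,
          p.2 *m d0 F = d0 G *m p.1 & p.1 *m d1 F = d1 G *m p.2] >].

Lemma mf_mor_submod F G : submod_closed (@mf_mor F G).
Proof.
split=> [|c p q /asboolP[p0 p1 pd0 pd1] /asboolP[q0 q1 qd0 qd1]].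
  by apply/asboolP; split; rewrite /= ?mul0mx ?mulmx0 //; apply: ghom0.
apply/asboolP; split=> /=; try exact: ghomDZ.
  by rewrite mulmxDl mulmxDr -scalemxAl -scalemxAr pd0 qd0.
by rewrite mulmxDl mulmxDr -scalemxAl -scalemxAr pd1 qd1.
Qed.
HB.instance Definition _ F G :=
  GRing.isSubmodClosed.Build k (premor F G) (@mf_mor F G) (mf_mor_submod F G).

Record mor (F G : gmf) :=
  Mor { mor_val : premor F G; _ : mor_val \in @mf_mor F G }.
HB.instance Definition _ F G := [isSub for @mor_val F G].
HB.instance Definition _ F G := [Choice of mor F G by <:].
HB.instance Definition _ F G := [SubChoice_isSubLmodule of mor F G by <:].

Lemma morP F G (p : mor F G) :
  [/\ ghom (mf0 F) (mf0 G) 0 (mor_val p).1, ghom (mf1 F) (mf1 G) 0 (mor_val p).2,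
      (mor_val p).2 *m d0 F = d0 G *m (mor_val p).1 & (mor_val p).1 *m d1 F = d1 G *m (mor_val p).2].
Proof. by case: p => p /= /asboolP. Qed.

Definition null_homotopic (F G : gmf) : {pred mor F G} := fun p =>
  `[< exists (h0 : 'M[S]_(grank (mf1 G), grank (mf0 F)))
             (h1 : 'M[S]_(grank (mf0 G), grank (mf1 F))),
      [/\ ghom (mf0 F) (mf1 G) (- h%:Z) h0, ghom (mf1 F) (mf0 G) 0 h1,
          (mor_val p).1 = h1 *m d0 F + d1 G *m h0 & (mor_val p).2 = d0 G *m h1 + h0 *m d1 F] >].

Lemma null_submod F G : submod_closed (@null_homotopic F G).
Proof.
split=> [|c p q /asboolP[p0 [p1 [hp0 hp1 e0 e1]]]
               /asboolP[q0 [q1 [hq0 hq1 e2 e3]]]].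
  apply/asboolP; exists 0, 0; rewrite !mulmx0 !mul0mx !addr0.
  by split=> //; apply: ghom0.
apply/asboolP; exists (c%:MP *: p0 + q0), (c%:MP *: p1 + q1).
split; try exact: ghomDZ.
  rewrite /= e0 e2 !mulmxDl !mulmxDr -!scalemxAl -!scalemxAr scalerDr.
  by rewrite addrACA.
rewrite /= e1 e3 !mulmxDl !mulmxDr -!scalemxAl -!scalemxAr scalerDr.
by rewrite addrACA.
Qed.
HB.instance Definition _ F G :=
  GRing.isSubmodClosed.Build k (mor F G) (@null_homotopic F G) (null_submod F G).

Definition hmf_hom (F G : gmf) : lmodType k := lquot (@null_homotopic F G).

Definition mor_id_val (F : gmf) : premor F F := (1%:M, 1%:M).
Lemma mor_id_proof F : mor_id_val F \in @mf_mor F F.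
Proof.
by apply/asboolP; split; rewrite /= ?mul1mx ?mulmx1 //; apply: ghom1.
Qed.
Definition mor_id F : mor F F := Mor (mor_id_proof F).

Definition mor_comp_val F G H (p : mor G H) (q : mor F G) : premor F H :=
  ((mor_val p).1 *m (mor_val q).1, (mor_val p).2 *m (mor_val q).2).
Lemma mor_comp_proof F G H (p : mor G H) (q : mor F G) :
  mor_comp_val p q \in @mf_mor F H.
Proof.
have [p0 p1 pd0 pd1] := morP p; have [q0 q1 qd0 qd1] := morP q.
apply/asboolP; split=> /=; try by rewrite -[0]addr0; apply: ghomM; eassumption.
  by rewrite -mulmxA qd0 !mulmxA pd0.
by rewrite -mulmxA qd1 !mulmxA pd1.
Qed.
Definition mor_comp F G H (p : mor G H) (q : mor F G) : mor F H :=
  Mor (mor_comp_proof p q).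

Lemma mor_eq F G (p q : mor F G) : (mor_val p).1 = (mor_val q).1 -> (mor_val p).2 = (mor_val q).2 -> p = q.
Proof.
move=> e1 e2; apply: val_inj => /=; move: e1 e2.
by case: (mor_val p) (mor_val q) => [a b] [c d] /= -> ->.
Qed.

Lemma mor_comp_linearl F G H (q : mor F G) :
  linear (fun p : mor G H => mor_comp p q).
Proof.
by move=> a p p'; apply: mor_eq; rewrite /= mulmxDl -scalemxAl.
Qed.
Lemma mor_comp_linearr F G H (p : mor G H) :
  linear (fun q : mor F G => mor_comp p q).
Proof.
by move=> a q q'; apply: mor_eq; rewrite /= mulmxDr -scalemxAr.
Qed.

Lemma null_compl F G H (p : mor G H) (q : mor F G) :
  p \in @null_homotopic G H -> mor_comp p q \in @null_homotopic F H.
Proof.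
move=> /asboolP[h0 [h1 [hh0 hh1 e0 e1]]]; have [q0 q1 qd0 qd1] := morP q.
apply/asboolP; exists (h0 *m (mor_val q).1), (h1 *m (mor_val q).2); split.
- by rewrite -[- _]add0r; apply: ghomM hh0 q0.
- by rewrite -[0]addr0; apply: ghomM hh1 q1.
- by rewrite /= e0 mulmxDl -!mulmxA qd0.
- by rewrite /= e1 mulmxDl -!mulmxA qd1.
Qed.

Lemma null_compr F G H (p : mor G H) (q : mor F G) :
  q \in @null_homotopic F G -> mor_comp p q \in @null_homotopic F H.
Proof.
move=> /asboolP[h0 [h1 [hh0 hh1 e0 e1]]]; have [p0 p1 pd0 pd1] := morP p.
apply/asboolP; exists ((mor_val p).2 *m h0), ((mor_val p).1 *m h1); split.
- by rewrite -[- _]addr0; apply: ghomM p1 hh0.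
- by rewrite -[0]addr0; apply: ghomM p0 hh1.
- by rewrite /= e0 mulmxDr !mulmxA pd1.
- by rewrite /= e1 mulmxDr !mulmxA pd0.
Qed.

Definition hmf_class F G (p : mor F G) : hmf_hom F G :=
  @lpi k _ (@null_homotopic F G) p.
Definition hmf_repr F G (x : hmf_hom F G) : mor F G :=
  @lrepr k _ (@null_homotopic F G) x.

Definition hmf_id F : hmf_hom F F := hmf_class (mor_id F).
Definition hmf_comp F G H (x : hmf_hom G H) (y : hmf_hom F G) : hmf_hom F H :=
  hmf_class (mor_comp (hmf_repr x) (hmf_repr y)).

Lemma hmf_reprK F G (x : hmf_hom F G) : hmf_class (hmf_repr x) = x.
Proof. exact: lreprK. Qed.

Lemma hmf_class_eq F G (p q : mor F G) :
  hmf_class p = hmf_class q <-> p - q \in @null_homotopic F G.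
Proof. exact: lpi_eq. Qed.

Lemma hmf_class_linear F G : linear (@hmf_class F G).
Proof. exact: lpi_linear. Qed.

Lemma hmf_compE F G H (p : mor G H) (q : mor F G) :
  hmf_comp (hmf_class p) (hmf_class q) = hmf_class (mor_comp p q).
Proof.
have [np nq] : hmf_repr (hmf_class p) - p \in @null_homotopic G H /\
    hmf_repr (hmf_class q) - q \in @null_homotopic F G.
  by split; apply/hmf_class_eq; rewrite hmf_reprK.
rewrite /hmf_comp; set p' := hmf_repr _ in np *; set q' := hmf_repr _ in nq *.
apply/hmf_class_eq.
have -> : mor_comp p' q' - mor_comp p q =
          mor_comp (p' - p) q' + mor_comp p (q' - q).
  apply: mor_eq; rewrite /= mulmxBl mulmxBr addrA.
    by rewrite subrK.
  by rewrite subrK.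
by apply: rpredD; [apply: null_compl | apply: null_compr].
Qed.

Lemma hmf_compA A B C D (x : hmf_hom C D) (y : hmf_hom B C) (z : hmf_hom A B) :
  hmf_comp x (hmf_comp y z) = hmf_comp (hmf_comp x y) z.
Proof.
rewrite -[x]hmf_reprK -[y]hmf_reprK -[z]hmf_reprK !hmf_compE.
by congr hmf_class; apply: mor_eq; rewrite /= mulmxA.
Qed.
Lemma hmf_comp1m A B (x : hmf_hom A B) : hmf_comp (hmf_id B) x = x.
Proof.
rewrite -[x]hmf_reprK hmf_compE.
by congr hmf_class; apply: mor_eq; rewrite /= mul1mx.
Qed.
Lemma hmf_compm1 A B (x : hmf_hom A B) : hmf_comp x (hmf_id A) = x.
Proof.
rewrite -[x]hmf_reprK hmf_compE.
by congr hmf_class; apply: mor_eq; rewrite /= mulmx1.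
Qed.
Lemma hmf_comp_linearl A B C (y : hmf_hom A B) :
  linear (fun x : hmf_hom B C => hmf_comp x y).
Proof.
move=> a x x'; rewrite -[x]hmf_reprK -[x']hmf_reprK -[y]hmf_reprK.
rewrite -hmf_class_linear !hmf_compE -hmf_class_linear.
by rewrite mor_comp_linearl.
Qed.
Lemma hmf_comp_linearr A B C (x : hmf_hom B C) :
  linear (fun y : hmf_hom A B => hmf_comp x y).
Proof.
move=> a y y'; rewrite -[y]hmf_reprK -[y']hmf_reprK -[x]hmf_reprK.
rewrite -hmf_class_linear !hmf_compE -hmf_class_linear.
by rewrite mor_comp_linearr.
Qed.

Definition HMF : lincat k :=
  @LinCat k gmf hmf_hom hmf_id hmf_comp hmf_compA hmf_comp1m hmf_compm1
    hmf_comp_linearl hmf_comp_linearr.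

Definition mf_shift (F : gmf) : gmf :=
  @GMF (gshift (mf0 F)) (gshift (mf1 F)) (d0 F) (d1 F)
    (ghom_shift (@d0_graded F)) (ghom_shift (@d1_graded F)) (d1d0 F) (d0d1 F).

Lemma mor_shift_proof F G (p : mor F G) :
  (mor_val p : premor (mf_shift F) (mf_shift G)) \in
    @mf_mor (mf_shift F) (mf_shift G).
Proof.
have [p0 p1 pd0 pd1] := morP p; apply/asboolP; split=> //.
  exact: ghom_shift p0.
exact: ghom_shift p1.
Qed.
Definition mor_shift F G (p : mor F G) : mor (mf_shift F) (mf_shift G) :=
  Mor (mor_shift_proof p).

Lemma null_shift F G (p : mor F G) : p \in @null_homotopic F G ->
  mor_shift p \in @null_homotopic (mf_shift F) (mf_shift G).
Proof.
move=> /asboolP[h0 [h1 [hh0 hh1 e0 e1]]]; apply/asboolP; exists h0, h1.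
by split=> //; [exact: ghom_shift hh0 | exact: ghom_shift hh1].
Qed.

Definition hmf_shift F G (x : hmf_hom F G) : hmf_hom (mf_shift F) (mf_shift G) :=
  hmf_class (mor_shift (hmf_repr x)).

Lemma mor_shift_linear F G : linear (@mor_shift F G).
Proof. by move=> a p q; apply: mor_eq. Qed.

Lemma hmf_shiftE F G (p : mor F G) :
  hmf_shift (hmf_class p) = hmf_class (mor_shift p).
Proof.
have np : hmf_repr (hmf_class p) - p \in @null_homotopic F G.
  by apply/hmf_class_eq; rewrite hmf_reprK.
apply/hmf_class_eq; move/null_shift: np.
by set u := mor_shift _; set v := (_ - _); have -> : u = v by apply: mor_eq.
Qed.

Lemma hmf_shift1 F : hmf_shift (hmf_id F) = hmf_id (mf_shift F).
Proof. by rewrite hmf_shiftE; congr hmf_class; apply: mor_eq. Qed.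
Lemma hmf_shift_comp F G H (x : hmf_hom G H) (y : hmf_hom F G) :
  hmf_shift (hmf_comp x y) = hmf_comp (hmf_shift x) (hmf_shift y).
Proof.
rewrite -[x]hmf_reprK -[y]hmf_reprK (hmf_compE (hmf_repr x)) !hmf_shiftE hmf_compE.
by congr hmf_class; apply: mor_eq.
Qed.
Lemma hmf_shift_linear F G : linear (@hmf_shift F G).
Proof.
move=> a x y; rewrite -[x]hmf_reprK -[y]hmf_reprK -hmf_class_linear !hmf_shiftE.
by rewrite mor_shift_linear hmf_class_linear.
Qed.

Definition tau : linfunctor HMF HMF :=
  @LinFunctor k HMF HMF mf_shift hmf_shift hmf_shift1 hmf_shift_comp
    hmf_shift_linear.

End MatrixFactorizations.

Section Deformation.
Variables (k : fieldType) (mu : nat) (t : 'I_mu -> k).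

(* t i stands for t_(i+1): the ordinal i is shifted by one throughout. *)
Definition f_tilde : {mpoly k[2]} :=
  let x := 'X_ord0 in let q := 'X_ord_max in
  x ^+ mu.+1 + \sum_(i < mu) t i *: (x ^+ (mu - i.+1) * q ^+ i.+2).

(* The s_i are determined by t up to permutation only, so the choice of s in
   the existential is immaterial. *)
Definition generic_parameter : Prop :=
  exists s : 'I_mu.+1 -> k,
    [/\ \sum_i s i = 0,
        forall i : 'I_mu, t i = (mesym mu.+1 k i.+2).@[s]
      & injective s].

End Deformation.

(* Main.v *)
From HB Require Import structures.
Require Import Defs.
From mathcomp Require Import all_boot all_order all_algebra reals complex.
From mathcomp Require Import boolp mpoly zify.
Import Defs.

Set Implicit Arguments.
Unset Strict Implicit.
Unset Printing Implicit Defensive.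

Import Order.TTheory GRing.Theory Num.Theory.
Local Open Scope ring_scope.

(** Genericity says that f is a product of n + 1 = mu + 1 pairwise
non-proportional linear forms x - r_i q. Everything about a factorization
A = d0, B = d1 of f is then read off at the nodes, the points (r_i, 1). There
AB = BA = 0, and with A', B' the derivatives in x and w_i the value of
df/dx, the Leibniz rule gives A'B + AB' = w_i. Hence A'B / w_i is a projector
whose kernel is the image of A: it is a model of the fibre of coker A at the
node.

For an endomorphism W of degree n - 1, i.e. a morphism F -> tau^(n-1) F, put

  Tr W = sum_i tr (W_1 A' B)(r_i) / w_i^2,

the sum of the residues of (trace of W on coker A) dx / f. Three facts make
it a trace defining Serre duality.

- It kills null-homotopic W: what survives is the sum of the residues of p / f
  with p = tr (h_0 B) homogeneous of degree n - 1, which is zero by Euler's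
  formula ([residue_sum], [residue_trace_null]).
- It is cyclic, since morphisms commute with the projectors up to terms of
  trace zero ([residue_trace_cyclic]).
- It is nondegenerate ([residue_nondegenerate]). A morphism phi : F -> G is
  null-homotopic as soon as some h_0 of the right degree satisfies
  B_G phi_1 = B_G h_0 B_F at the nodes, because the other homotopy component is
  then obtained by dividing by f ([null_from_nodes]). This is a problem in
  finite-dimensional linear algebra: if it has no solution, some functional
  z |-> sum_i tr (c_i z_i) separates the values of B_G phi_1 from all the
  B_G h_0 B_F. Lagrange interpolation turns such a functional into a polynomial
  matrix E with E(r_i) = w_i B_F c_i B_G ([trace_dual_interpolation]), and E
  factors as B_F w_1 = w_0 B_G for a morphism w : G -> tau^(n-1) F with
  Tr (w phi) = sum_i tr (c_i B_G phi_1)(r_i), which is not zero.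

The pairing (phi, w) |-> Tr (w phi) is therefore nondegenerate on both sides,
and it is perfect because the Hom spaces are finite-dimensional: the entries of
the matrices are homogeneous of prescribed degrees. Finally the mu - 1 fold
iterate of tau is naturally isomorphic to the shift by the integer n - 1, along
which a trace can be transported. *)

(** * Finite-dimensional linear algebra *)

Section Subspaces.
Variable k : fieldType.

Lemma submx_test m n (B : 'M[k]_(m, n)) (y : 'rV_n) :
  (forall z : 'cV_n, B *m z = 0 -> y *m z = 0) -> (y <= B)%MS.
Proof.
move=> H; rewrite submxE; apply/eqP/matrixP=> i j.
have: y *m col j (cokermx B) = 0.
  by apply: H; rewrite colE mulmxA mulmx_coker mul0mx.
by rewrite colE mulmxA -colE => /matrixP/(_ i ord0); rewrite !mxE.
Qed.

(** A subspace given by a bare predicate is spanned by a matrix: take rows in P of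
maximal rank. *)
Lemma subspace_rowspace n (P : 'rV[k]_n -> Prop) :
    P 0 -> (forall a u v, P u -> P v -> P (a *: u + v)) ->
  exists B : 'M[k]_n, (forall i, P (row i B)) /\ (forall y, P y -> (y <= B)%MS).
Proof.
move=> P0 Plin.
have Pcomb m (B : 'M_(m, n)) y : (forall i, P (row i B)) -> (y <= B)%MS -> P y.
  move=> PB /submxP[D ->]; rewrite mulmx_sum_row.
  by elim/big_ind: _ => [//|u v Pu Pv|i _];
    [rewrite -[u]scale1r|rewrite -[_ *: _]addr0]; apply: Plin.
pose Q r := `[< exists B : 'M[k]_n, (forall i, P (row i B)) /\ \rank B = r >].
have exQ : exists r, Q r.
  exists 0%N; apply/asboolP; exists 0; split; last by rewrite mxrank0.
  by move=> i; rewrite row0.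
have Qle r : Q r -> (r <= n)%N.
  by case/asboolP=> B [_ <-]; apply: rank_leq_row.
case: (ex_maxnP exQ Qle) => r /asboolP[B [PB rB]] maxr.
exists B; split=> // y Py.
pose C := col_mx B y.
have PC i : P (row i C).
  rewrite -(splitK i); case: split => j /=; rewrite ?(rowKu, rowKd) //.
  by rewrite [j]ord1 row_id.
have: (\rank C <= r)%N.
  apply: maxr; apply/asboolP; exists <<C>>%MS; split; last by rewrite mxrank_gen.
  by move=> i; apply: Pcomb PC _; rewrite (submx_trans (row_sub i _)) ?genmxE.
have BC : (B <= C)%MS by rewrite -addsmxE addsmxSl.
have yC : (y <= C)%MS by rewrite -addsmxE addsmxSr.
rewrite -rB => rC; apply: submx_trans yC _.
by rewrite -(geq_leqif (mxrank_leqif_sup BC)).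
Qed.

Variable J : finType.

Let vec (y : J -> k) : 'rV[k]_#|J| := \row_i y (enum_val i).
Let vecK y i : vec y 0 (enum_rank i) = y i.
Proof. by rewrite mxE enum_rankK. Qed.

Lemma subspace_span (P : (J -> k) -> Prop) :
    P (fun=> 0) ->
    (forall a u v, P u -> P v -> P (fun j => a * u j + v j)) ->
  exists (n : nat) (e : 'I_n -> J -> k), (forall i, P (e i)) /\
    (forall y, P y -> exists c : 'I_n -> k, forall j, y j = \sum_i c i * e i j).
Proof.
move=> P0 Plin; pose un (v : 'rV[k]_#|J|) j := v 0 (enum_rank j).
have [|a u v Pu Pv|B [PB spB]] := @subspace_rowspace _ (fun v => P (un v)).
- by rewrite (_ : un 0 = fun=> 0) //; apply/funext => j; rewrite /un mxE.
- rewrite (_ : un _ = fun j => a * un u j + un v j); first exact: Plin.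
  by apply/funext => j; rewrite /un !mxE.
exists #|J|, (fun i => un (row i B)); split=> // y Py.
have /submxP[D eD] : (vec y <= B)%MS.
  by apply: spB; rewrite (_ : un _ = y) //; apply/funext => j; apply: vecK.
exists (D 0) => j; rewrite -vecK eD !mxE; apply: eq_bigr => i _.
by rewrite /un !mxE.
Qed.

(** Double annihilator: a vector on which every functional killing P vanishes
lies in P. This is how solvability of a linear system is reduced to its dual. *)
Lemma subspace_test (P : (J -> k) -> Prop) (y : J -> k) :
    P (fun=> 0) ->
    (forall a u v, P u -> P v -> P (fun j => a * u j + v j)) ->
    (forall z : J -> k, (forall u, P u -> \sum_j u j * z j = 0) ->
       \sum_j y j * z j = 0) ->
  P y.
Proof.
move=> P0 Plin test.
have [n [e [Pe spe]]] := subspace_span P0 Plin.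
pose B := \matrix_(i < n, j < #|J|) e i (enum_val j).
have sumE (u z : J -> k) :
    \sum_j u j * z j = \sum_(i < #|J|) u (enum_val i) * z (enum_val i).
  rewrite (reindex (@enum_val J predT)) //=.
  by exists enum_rank => j _; [exact: enum_valK|exact: enum_rankK].
have /submxP[D eD] : (vec y <= B)%MS.
  apply: submx_test => z Bz; apply/matrixP=> i0 j0; rewrite !ord1 !mxE.
  pose z' j := z (enum_rank j) 0.
  have zE j : z' (enum_val j) = z j 0 by rewrite /z' enum_valK.
  have := test z'; rewrite sumE => T.
  rewrite -[RHS]T; first by apply: eq_bigr => j _; rewrite mxE zE.
  move=> u /spe[c uE].
  under eq_bigr do rewrite uE mulr_suml.
  rewrite exchange_big big1 //= => i _.
  under eq_bigr do rewrite -mulrA.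
  rewrite -mulr_sumr sumE.
  move/matrixP/(_ i 0): Bz; rewrite !mxE => Bz.
  rewrite -[RHS](mulr0 (c i)) -[in RHS]Bz; congr (_ * _).
  by apply: eq_bigr => j _; rewrite mxE zE.
have -> : y = fun j => \sum_i D 0 i * e i j.
  apply/funext => j; rewrite -vecK eD mxE.
  by apply: eq_bigr => i _; rewrite mxE enum_rankK.
have : forall s : seq 'I_n, P (fun j => \sum_(i <- s) D 0 i * e i j).
  elim=> [|i s IHs].
    by rewrite (_ : (fun j => _) = fun=> 0) //; apply/funext => j; rewrite big_nil.
  rewrite (_ : (fun j => _) = fun j => D 0 i * e i j + \sum_(i <- s) D 0 i * e i j).
    exact: Plin.
  by apply/funext => j; rewrite big_cons.
exact.
Qed.

End Subspaces.

(** * Lagrange interpolation *)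

Section Lagrange.
Variables (k : fieldType) (h : nat) (r : 'I_h.+1 -> k).
Hypothesis r_inj : injective r.

Definition node_poly : {poly k} := \prod_i ('X - (r i)%:P).
Definition lagrange_num (i : 'I_h.+1) : {poly k} := \prod_(j | j != i) ('X - (r j)%:P).
(** The value at r_i of the derivative of the node polynomial. *)
Definition node_weight (i : 'I_h.+1) : k := \prod_(j | j != i) (r i - r j).

Lemma node_weight_neq0 i : node_weight i != 0.
Proof.
apply/prodf_neq0 => j ji; rewrite subr_eq0.
by apply: contra_neq ji => /r_inj.
Qed.

Lemma lagrange_numE i j : (lagrange_num i).[r j] = (node_weight i) *+ (i == j).
Proof.
rewrite horner_prod; case: eqVneq => [->|ij].
  by apply: eq_bigr => l _; rewrite hornerXsubC.
by rewrite (bigD1 j) 1?eq_sym //= hornerXsubC subrr mul0r.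
Qed.

Lemma size_node_poly : size node_poly = h.+2.
Proof. by rewrite size_prod_XsubC /index_enum -enumT size_enum_ord. Qed.

Lemma lagrange_num_monic i : lagrange_num i \is monic.
Proof. exact: monic_prod_XsubC. Qed.

Lemma size_lagrange_num i : size (lagrange_num i) = h.+1.
Proof.
have := size_node_poly; rewrite /node_poly (bigD1 i) //= -/(lagrange_num i).
by rewrite size_Mmonic ?polyXsubC_eq0 ?lagrange_num_monic // size_XsubC; case.
Qed.

Lemma eq_at_nodes (P Q : {poly k}) : (size P <= h.+1)%N -> (size Q <= h.+1)%N ->
  (forall i, P.[r i] = Q.[r i]) -> P = Q.
Proof.
move=> sP sQ PQ; apply/eqP; rewrite -subr_eq0; apply/eqP.
apply: (@roots_geq_poly_eq0 _ _ [seq r i | i <- enum 'I_h.+1]).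
- by apply/allP => _ /mapP[i _ ->]; rewrite rootE hornerD hornerN PQ subrr.
- by rewrite map_inj_uniq ?enum_uniq.
- rewrite size_map size_enum_ord.
  by rewrite (leq_trans (size_polyD _ _)) // geq_max sP size_polyN.
Qed.

Lemma node_poly_dvd (P : {poly k}) : (forall i, P.[r i] = 0) ->
  exists Q, P = node_poly * Q.
Proof.
move=> P0; have [||Q ->] := @uniq_roots_prod_XsubC _ P [seq r i | i <- index_enum 'I_h.+1].
- by apply/allP => _ /mapP[i _ ->]; rewrite rootE P0.
- by rewrite uniq_rootsE map_inj_uniq ?index_enum_uniq.
by exists Q; rewrite big_map mulrC.
Qed.

Definition interp (D : 'I_h.+1 -> k) : {poly k} := \sum_i D i *: lagrange_num i.

Lemma size_interp D : (size (interp D) <= h.+1)%N.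
Proof.
apply: (leq_trans (size_sum _ _ _)); apply/bigmax_leqP => i _.
by rewrite (leq_trans (size_scale_leq _ _)) // size_lagrange_num.
Qed.

Lemma interpE D i : (interp D).[r i] = node_weight i * D i.
Proof.
rewrite horner_sum (bigD1 i) //= big1 ?addr0 => [|j ji].
  by rewrite hornerZ lagrange_numE eqxx mulrC.
by rewrite hornerZ lagrange_numE (negPf ji) mulr0.
Qed.

(** Euler's formula: the sum of the residues of P / node_poly. Both sides are the
coefficient of 'X^h in the Lagrange interpolation formula for P. *)
Lemma sum_residues (P : {poly k}) : (size P <= h.+1)%N ->
  \sum_i P.[r i] / node_weight i = P`_h.
Proof.
move=> sP; have {2}-> : P = interp (fun i => P.[r i] / node_weight i).
  apply: eq_at_nodes; rewrite ?size_interp // => i.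
  by rewrite interpE mulrC divfK ?node_weight_neq0.
rewrite coef_sum; apply: eq_bigr => i _; rewrite coefZ.
have /monicP := lagrange_num_monic i.
by rewrite lead_coefE size_lagrange_num /= => ->; rewrite mulr1.
Qed.

(** Vanishing moments lower the degree of the interpolant: if its degree m were too
large, Euler's formula applied to 'X^(h - m) times the interpolant would express
its leading coefficient as the moment of order h - m, which is zero. *)
Lemma size_interp_orth D n :
    (forall l, (l < n)%N -> \sum_i D i * r i ^+ l = 0) ->
  interp D = 0 \/ (size (interp D) + n <= h.+1)%N.
Proof.
move=> Dorth; have [->|P0] := eqVneq (interp D) 0; first by left.
right; set P := interp D in P0 *; have sP : (size P <= h.+1)%N := size_interp D.
have sP0 : (0 < size P)%N by rewrite size_poly_gt0.
rewrite leqNgt; apply/negP => big.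
have Q_size : size (P * 'X^(h.+1 - size P)) = h.+1.
  by rewrite size_Mmonic ?monicXn // size_polyXn addnS /= subnKC.
have := sum_residues (eq_leq Q_size).
rewrite coefMXn ltnNge.
have -> : (h.+1 - size P <= h)%N.
  by rewrite leq_subLR; case: (size P) sP0 => // m _; rewrite addSn ltnS leq_addl.
rewrite /=; have -> : (h - (h.+1 - size P))%N = (size P).-1.
  by case: (size P) sP0 sP => // m _; rewrite ltnS subSS /= => mh; rewrite subKn.
move=> E; have : lead_coef P = 0; last by move/eqP; rewrite lead_coef_eq0 (negPf P0).
rewrite lead_coefE -E -[RHS](Dorth (h.+1 - size P)%N).
  apply: eq_bigr => i _; rewrite hornerM hornerXn interpE.
  by rewrite -!mulrA mulrC -!mulrA mulVf ?node_weight_neq0 // mulr1.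
by rewrite ltn_subLR // addnC.
Qed.

End Lagrange.

(** * Homogeneous polynomials in two variables *)

Section Dehomogenization.
Variable k : fieldType.
Local Notation S := {mpoly k[2]}.
Local Notation x := ('X_ord0 : S).
Local Notation q := ('X_ord_max : S).

(** Setting x = 'X and q = 1 loses nothing on polynomials of a fixed degree, so that
questions about homogeneous polynomials become questions about univariate ones
of bounded size. *)
Definition deh (p : S) : {poly k} :=
  mmap (@polyC k) (fun i => if i == ord0 then 'X else 1) p.
HB.instance Definition _ := GRing.RMorphism.copy deh
  (mmap (@polyC k) (fun i => if i == ord0 then 'X else 1)).

Definition ev (c : k) (p : S) : k := p.@[fun i => if i == ord0 then c else 1].
HB.instance Definition _ c := GRing.RMorphism.copy (ev c)
  (meval (fun i : 'I_2 => if i == ord0 then c else 1)).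

Lemma deh_x : deh x = 'X. Proof. by rewrite [LHS]mmapX mmap1U. Qed.
Lemma deh_q : deh q = 1. Proof. by rewrite [LHS]mmapX mmap1U. Qed.
Lemma dehZ c p : deh (c *: p) = c *: deh p.
Proof. by rewrite [LHS]mmapZ mul_polyC. Qed.

Lemma ev_deh c p : ev c p = (deh p).[c].
Proof.
rewrite /ev /deh /meval /mmap horner_sum; apply: eq_bigr => m _.
rewrite hornerM hornerC horner_prod; congr (_ * _).
by apply: eq_bigr => i _; rewrite horner_exp; case: ifP; rewrite ?hornerX ?hornerC.
Qed.

Definition homogenize (d : int) (P : {poly k}) : S :=
  if d is Posz n then \sum_(i < n.+1) P`_i *: (x ^+ i * q ^+ (n - i)) else 0.

Arguments homogenize : simpl never.

Lemma homogenizeP d P : in_degree d (homogenize d P).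
Proof.
case: d => n; last exact: eqxx.
apply: rpred_sum => i _; apply: dhomogZ.
have : x ^+ i * q ^+ (n - i) \is (1 * i + 1 * (n - i)).-homog.
  by apply: dhomogM; apply: dhomogMn; rewrite dhomogX; apply/eqP/mdeg1.
by rewrite !mul1n subnKC // -ltnS.
Qed.

Lemma homogenize_linear d : linear (homogenize d).
Proof.
move=> a P Q; rewrite /homogenize; case: d => n; last by rewrite scaler0 addr0.
rewrite scaler_sumr -big_split; apply: eq_bigr => i _ /=.
by rewrite coefD coefZ scalerDl scalerA.
Qed.
HB.instance Definition _ d :=
  GRing.isLinear.Build k {poly k} S _ (homogenize d) (homogenize_linear d).

Lemma dehK d p : in_degree d p -> homogenize d (deh p) = p.
Proof.
case: d => n; last by move=> /eqP->; rewrite /deh mmap0 linear0.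
move=> /dhomogP hp; rewrite [in RHS](mpolyE p) [in LHS](mpolyE p).
rewrite rmorph_sum linear_sum /=; apply: eq_big_seq => m /hp dm.
rewrite dehZ linearZ; congr (_ *: _).
have {}dm : (m ord0 + m ord_max = n)%N.
  by rewrite -dm /= mdegE !big_ord_recl big_ord0 addn0; congr (_ + m _)%N; apply: val_inj.
have -> : 'X_[m] = x ^+ m ord0 * q ^+ m ord_max :> S.
  rewrite mpolyXE_id !big_ord_recl big_ord0 mulr1.
  by congr (_ * 'X_ _ ^+ m _); apply: val_inj.
rewrite rmorphM !rmorphXn /= deh_x deh_q expr1n mulr1.
have lt : (m ord0 < n.+1)%N by rewrite -dm ltnS leq_addr.
rewrite /homogenize (bigD1 (Ordinal lt)) //= coefXn eqxx scale1r big1 ?addr0.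
  by rewrite -dm addKn.
move=> i /eqP ni; rewrite coefXn; case: eqP => [ei|]; last by rewrite scale0r.
by case: ni; apply: val_inj.
Qed.

Lemma deh_inj d p p' : in_degree d p -> in_degree d p' -> deh p = deh p' -> p = p'.
Proof. by move=> /dehK {2}<- /dehK {2}<- ->. Qed.

(** The univariate polynomials of degree at most d; the first case is for d < -1,
where the size, a natural number, cannot be at most d + 1. *)
Definition size_bound (d : int) (P : {poly k}) := P = 0 \/ ((size P)%:Z <= d + 1)%R.

Lemma homogenizeK d P : size_bound d P -> deh (homogenize d P) = P.
Proof.
case=> [->|]; first by rewrite linear0 /deh mmap0.
case: d => n sP.
  rewrite /homogenize rmorph_sum /= -[RHS]coefK.
  transitivity (\sum_(i < n.+1) P`_i *: 'X^i : {poly k}).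
    apply: eq_bigr => i _.
    by rewrite dehZ rmorphM !rmorphXn /= deh_x deh_q expr1n mulr1.
  rewrite -poly_def; apply/polyP => i; rewrite !coef_poly.
  case: ifP => [lt|/negbT]; last rewrite -leqNgt.
    by case: ifP => // /negbT; rewrite -leqNgt => /leq_sizeP ->.
  by move=> ge; rewrite ltnNge (leq_trans _ ge) //; lia.
have /eqP : size P = 0%N by lia.
by rewrite size_poly_eq0 => /eqP ->; rewrite linear0 /deh mmap0.
Qed.

Lemma deh_size d p : in_degree d p -> size_bound d (deh p).
Proof.
move=> hp; rewrite -(dehK hp); case: d {hp} => n; last by left; rewrite /deh mmap0.
right; rewrite -PoszD addn1 lez_nat /homogenize rmorph_sum /=.
apply: (leq_trans (size_sum _ _ _)); apply/bigmax_leqP => i _.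
rewrite dehZ rmorphM !rmorphXn /= deh_x deh_q expr1n mulr1.
by rewrite (leq_trans (size_scale_leq _ _)) // size_polyXn.
Qed.

Lemma in_degreeD d (p p' : S) : in_degree d p -> in_degree d p' -> in_degree d (p + p').
Proof. by move=> hp hp'; rewrite -[p]mul1r -mpolyC1; apply: in_degreeDZ. Qed.

Lemma in_degreeM d e (p p' : S) :
  in_degree d p -> in_degree e p' -> in_degree (d + e) (p * p').
Proof.
case: d => d; last by move=> /eqP->; rewrite mul0r in_degree0.
by case: e => e; [apply: dhomogM|move=> _ /eqP->; rewrite mulr0 in_degree0].
Qed.

Lemma in_degree_sum (I : Type) (s : seq I) d (F : I -> S) :
  (forall i, in_degree d (F i)) -> in_degree d (\sum_(i <- s) F i).
Proof.
by move=> hF; elim/big_ind: _ => // [|p p']; [exact: in_degree0|exact: in_degreeD].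
Qed.

(** The converse direction tests the map on the basis vectors, which are homogeneous
of degree minus their twist. *)
Lemma ghomP (M N : gfree) d (A : 'M[S]_(grank N, grank M)) :
  ghom M N d A <-> forall i j, in_degree (d + gtwist i - gtwist j) (A i j).
Proof.
split=> [hA i j|hA s v hv i]; last first.
  rewrite mxE; apply: in_degree_sum => j.
  have -> : s + d + gtwist i = (d + gtwist i - gtwist j) + (s + gtwist j) by lia.
  exact: in_degreeM.
have := hA (- gtwist j) (delta_mx j 0) => /(_ _ i).
rewrite -colE mxE (_ : - gtwist j + d + _ = d + gtwist i - gtwist j); last by lia.
apply=> l; rewrite mxE andbT; case: eqP => [->|_]; last exact: in_degree0.
by rewrite addNr; exact: dhomog1.
Qed.

End Dehomogenization.

(** * Products of distinct linear forms *)

Section Lines.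
Variables (k : fieldType) (n : nat) (r : 'I_n.+1 -> k).
Hypothesis r_inj : injective r.
Local Notation S := {mpoly k[2]}.
Local Notation x := ('X_ord0 : S).
Local Notation q := ('X_ord_max : S).

Definition line_product : S := \prod_i (x - r i *: q).
Local Notation f := line_product.
Local Notation w := (node_weight r).

Lemma deh_line_product : deh f = node_poly r.
Proof.
rewrite rmorph_prod; apply: eq_bigr => i _ /=.
by rewrite rmorphB /= dehZ deh_x deh_q alg_polyC.
Qed.

Lemma line_product_homog : in_degree n.+1%:Z f.
Proof.
have -> : n.+1 = (\sum_(i < n.+1) 1)%N by rewrite sum1_card card_ord.
rewrite /f /=; elim/big_ind2: _ => [|d p e p'|i _]; first exact: dhomog1.
  by move=> hp hp'; apply: dhomogM.
by apply: rpredB; [|apply: rpredZ]; rewrite dhomogX; apply/eqP/mdeg1.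
Qed.

Lemma line_product_neq0 : f != 0.
Proof.
apply/eqP => f0; have := deh_line_product; rewrite f0 rmorph0 => /esym/eqP.
by rewrite -size_poly_eq0 size_node_poly.
Qed.

Lemma ev_line_product i : ev (r i) f = 0.
Proof.
by rewrite ev_deh deh_line_product horner_prod (bigD1 i) //= hornerXsubC subrr mul0r.
Qed.

Lemma ev_deriv_line_product i : ev (r i) f^`M(ord0) = w i.
Proof.
rewrite /f (bigD1 i) //= mderivM rmorphD !rmorphM /=.
rewrite [ev _ (x - _)]ev_deh rmorphB /= dehZ deh_x deh_q alg_polyC.
rewrite hornerXsubC subrr mul0r addr0 mderivB mderivZ !mderivX.
rewrite rmorphB /= [ev _ (_ *: (_ *: _))]ev_deh !dehZ !mnmE /= !scale0r scaler0 horner0 subr0.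
rewrite scale1r [X in 'X_[X]](_ : _ = 0%MM); last first.
  by apply/mnmP => j; rewrite !mnmE subnn.
rewrite mpolyX0 rmorph1 mul1r rmorph_prod; apply: eq_bigr => j _ /=.
by rewrite ev_deh rmorphB /= dehZ deh_x deh_q alg_polyC hornerXsubC.
Qed.

Lemma vanishing_divisible d (p : S) :
    in_degree d p -> (forall i, ev (r i) p = 0) ->
  exists p', in_degree (d - n.+1%:Z) p' /\ p = f * p'.
Proof.
move=> hp p0; have [|Q PQ] := @node_poly_dvd _ _ _ r_inj (deh p).
  by move=> i; rewrite -ev_deh.
have sQ : size_bound (d - n.+1%:Z) Q.
  have [->|Q0] := eqVneq Q 0; first by left.
  right; case: (deh_size hp); rewrite PQ.
    move/eqP; rewrite mulf_eq0 (negPf Q0) orbF -size_poly_eq0 size_node_poly.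
    by [].
  rewrite mulrC size_Mmonic ?monic_prod_XsubC // size_node_poly.
  by lia.
exists (homogenize (d - n.+1%:Z) Q); split; first exact: homogenizeP.
apply: (@deh_inj _ d) => //.
  have := in_degreeM line_product_homog (homogenizeP (d - n.+1%:Z) Q).
  by rewrite addrC subrK.
by rewrite rmorphM /= homogenizeK // deh_line_product.
Qed.

(** A form of degree n - 1 has dehomogenization of degree less than n, so the
coefficient in Euler's formula is zero. *)
Lemma residue_sum (p : S) : in_degree (n%:Z - 1) p ->
  \sum_i ev (r i) p / w i = 0.
Proof.
move=> /deh_size sP.
have {sP} sP : (size (deh p) <= n)%N.
  by case: sP => [->|]; [rewrite size_poly0|lia].
under eq_bigr do rewrite ev_deh.
by rewrite (sum_residues r_inj) ?(leq_trans sP) // nth_default.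
Qed.

(** A functional on the node values that kills the forms of degree e is a sum of
residues against a form of degree n - 1 - e: the duality between forms that
underlies Serre duality. It holds for all integers e, a negative e making the
hypothesis empty and a negative n - 1 - e making D zero. *)
Lemma interpolation (D : 'I_n.+1 -> k) (e : int) :
    (forall p : S, in_degree e p -> \sum_i D i * ev (r i) p = 0) ->
  exists E : S, in_degree (n%:Z - 1 - e) E /\ forall i, ev (r i) E = w i * D i.
Proof.
move=> Dorth; exists (homogenize (n%:Z - 1 - e) (interp r D)).
split=> [|i]; first exact: homogenizeP.
rewrite ev_deh homogenizeK ?interpE //.
have si := size_interp r D.
case: e Dorth => e Dorth; last by right; lia.
case: (@size_interp_orth _ _ _ r_inj D e.+1) => [l le|->|lt]; [|by left|by right; lia].
rewrite -[RHS](Dorth (x ^+ l * q ^+ (e - l))); last first.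
  have : x ^+ l * q ^+ (e - l) \is (1 * l + 1 * (e - l)).-homog.
    by apply: dhomogM; apply: dhomogMn; rewrite dhomogX; apply/eqP/mdeg1.
  by rewrite !mul1n subnKC // -ltnS.
apply: eq_bigr => i0 _; rewrite ev_deh rmorphM !rmorphXn /= deh_x deh_q expr1n mulr1.
by rewrite hornerXn.
Qed.

End Lines.

(** Vieta: the coefficient of q in the product is the sum of the s i, hence zero, and
the terms in the expansion of the product are grouped by the number of factors
from which q is taken. *)
Lemma f_tildeE (k : fieldType) (mu : nat) (t : 'I_mu -> k) (s : 'I_mu.+1 -> k) :
    \sum_i s i = 0 -> (forall i : 'I_mu, t i = (mesym mu.+1 k i.+2).@[s]) ->
  f_tilde t = line_product (fun i => - s i).
Proof.
move=> s0 ts; rewrite /line_product.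
under eq_bigr do rewrite scaleNr opprK addrC.
rewrite bigA_distr /=.
pose e (l : nat) := (mesym mu.+1 k l).@[s].
have eE l : e l = \sum_(J : {set 'I_mu.+1} | #|J| == l) \prod_(i in J) s i.
  rewrite /e /mesym rmorph_sum /=; apply: eq_bigr => J _.
  by rewrite rmorph_prod; apply: eq_bigr => i _ /=; rewrite mevalXU.
transitivity (\sum_(l < mu.+2) e l *: ('X_ord0 ^+ (mu.+1 - l) * 'X_ord_max ^+ l) : {mpoly k[2]}).
  rewrite !big_ord_recl /= /bump /=.
  have -> : e 0%N = 1 by rewrite /e mesym0E meval1.
  have -> : e 1%N = 0.
    rewrite /e mesym1E rmorph_sum /= -[RHS]s0; apply: eq_bigr => i _.
    by rewrite mevalXU.
  rewrite scale1r scale0r add0r subn0 expr0 mulr1 /f_tilde; congr (_ + _).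
  by apply: eq_bigr => i _; rewrite ts add1n subSS.
rewrite (partition_big (fun J : {set 'I_mu.+1} => inord #|J| : 'I_mu.+2) predT) //=.
apply: eq_bigr => l _; rewrite eE scaler_suml.
have lE (J : {set 'I_mu.+1}) : (#|J| == l :> nat) = (inord #|J| == l).
  by rewrite -val_eqE /= inordK // ltnS -[X in (_ <= X)%N](card_ord mu.+1) max_card.
apply: eq_big => [J|J /eqP cJ]; first exact: lE.
rewrite [RHS](bigID (mem J)) /=.
rewrite (eq_bigr (fun i => s i *: 'X_ord_max)) => [|i ->//].
rewrite (eq_bigr (fun i => 'X_ord0) (P := fun i => i \notin J)) => [|i /negPf->//].
rewrite scaler_prodr cJ -scalerAl mulrC.
have -> : \prod_(i | i \notin J) 'X_ord0 = 'X_ord0 ^+ #|~: J| :> {mpoly k[2]}.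
  by rewrite -prodr_const; apply: eq_bigl => i; rewrite inE.
by rewrite cardsCs setCK card_ord cJ.
Qed.

(** * The residue trace *)

Section Residues.
Variables (k : fieldType) (n : nat) (r : 'I_n.+1 -> k).
Hypothesis r_inj : injective r.
Local Notation S := {mpoly k[2]}.
Local Notation f := (line_product r).
Local Notation w := (node_weight r).
Local Notation MF := (gmf n.+1 f).
Local Notation A := (@d0 _ _ _).
Local Notation B := (@d1 _ _ _).

Definition evm i a b : 'M[S]_(a, b) -> 'M[k]_(a, b) := map_mx (ev (r i)).
Definition dvm i a b : 'M[S]_(a, b) -> 'M[k]_(a, b) :=
  map_mx (fun p => ev (r i) p^`M(ord0)).

Lemma evmD i a b (X Y : 'M[S]_(a, b)) : evm i (X + Y) = evm i X + evm i Y.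
Proof. exact: map_mxD. Qed.
Lemma evmB i a b (X Y : 'M[S]_(a, b)) : evm i (X - Y) = evm i X - evm i Y.
Proof. exact: map_mxB. Qed.
Lemma evmM i a b c (X : 'M[S]_(a, b)) (Y : 'M_(b, c)) :
  evm i (X *m Y) = evm i X *m evm i Y.
Proof. exact: map_mxM. Qed.
Lemma evmZ i a b p (X : 'M[S]_(a, b)) : evm i (p *: X) = ev (r i) p *: evm i X.
Proof. exact: map_mxZ. Qed.
Lemma evm_delta i a b u v : evm i (delta_mx u v : 'M[S]_(a, b)) = delta_mx u v.
Proof. exact: map_delta_mx. Qed.

Lemma dvmM i a b c (X : 'M[S]_(a, b)) (Y : 'M_(b, c)) :
  dvm i (X *m Y) = dvm i X *m evm i Y + evm i X *m dvm i Y.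
Proof.
apply/matrixP => u v; rewrite !mxE linear_sum rmorph_sum -big_split.
by apply: eq_bigr => j _; rewrite !mxE /= mderivM rmorphD !rmorphM.
Qed.

Lemma evm_f i a : evm i (f%:M : 'M_a) = 0.
Proof. by apply/matrixP => u v; rewrite !mxE rmorphMn /= ev_line_product mul0rn. Qed.

Lemma dvm_f i a : dvm i (f%:M : 'M_a) = (w i)%:M.
Proof.
apply/matrixP => u v; rewrite !mxE mderivMn rmorphMn /=.
by rewrite ev_deriv_line_product.
Qed.

Section Factorization.
Variable F : MF.
Lemma evm_AB i : evm i (A F) *m evm i (B F) = 0.
Proof. by rewrite -evmM d0d1 evm_f. Qed.
Lemma evm_BA i : evm i (B F) *m evm i (A F) = 0.
Proof. by rewrite -evmM d1d0 evm_f. Qed.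
Lemma dvm_AB i : dvm i (A F) *m evm i (B F) + evm i (A F) *m dvm i (B F) = (w i)%:M.
Proof. by rewrite -dvmM d0d1 dvm_f. Qed.

(** This is the idempotence of the projector A'B / w_i, multiplied by B. *)
Lemma evm_BdAB i : evm i (B F) *m dvm i (A F) *m evm i (B F) = w i *: evm i (B F).
Proof.
have : dvm i (A F) *m evm i (B F) = (w i)%:M - evm i (A F) *m dvm i (B F).
  by rewrite -(dvm_AB i) addrK.
rewrite -mulmxA => ->.
by rewrite mulmxBr mulmxA evm_BA mul0mx subr0 mul_mx_scalar.
Qed.

(** One factor w i turns A'B into the projector that models the fibre of coker A; the
other is the denominator of the residue. *)
Definition residue_trace (W : 'M[S]_(grank (mf1 F))) : k :=
  \sum_i \tr (evm i W *m dvm i (A F) *m evm i (B F)) / w i ^+ 2.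

Lemma residue_traceDZ c W W' :
  residue_trace (c%:MP *: W + W') = c * residue_trace W + residue_trace W'.
Proof.
rewrite mulr_sumr -big_split; apply: eq_bigr => i _ /=.
rewrite evmD evmZ [ev _ _]mevalC !mulmxDl -!scalemxAl.
by rewrite linearD linearZ mulrDl mulrA.
Qed.

Lemma ghom_trace d (X : 'M[S]_(grank (mf1 F))) :
  ghom (mf1 F) (mf1 F) d X -> in_degree d (\tr X).
Proof.
move=> /ghomP hX; apply: in_degree_sum => i.
by have := hX i i; rewrite addrK.
Qed.

(** The term with h1 has trace zero at the nodes because BA = 0 there; the term with
h0 reduces by [evm_BdAB] to the residues of tr (h0 B), whose degree is small
enough for their sum to vanish. *)
Lemma residue_trace_null (h0 : 'M[S]_(grank (mf1 F), grank (mf0 F))) h1 :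
    ghom (mf0 F) (mf1 F) (- 2%:Z) h0 ->
  residue_trace (A F *m h1 + h0 *m B F) = 0.
Proof.
move=> hh0.
have hd : in_degree (n%:Z - 1) (\tr (h0 *m B F)).
  apply: ghom_trace.
  rewrite (_ : n%:Z - 1 = n.+1%:Z + - 2%:Z); last by lia.
  by apply: ghomM hh0 _; apply: d1_graded.
rewrite -(residue_sum r_inj hd); apply: eq_bigr => i _.
rewrite evmD !evmM !mulmxDl linearD /=.
have -> : \tr (evm i (A F) *m evm i h1 *m dvm i (A F) *m evm i (B F)) = 0.
  by rewrite mxtrace_mulC !mulmxA evm_BA !mul0mx linear0.
rewrite add0r -!mulmxA [evm i (B F) *m _]mulmxA evm_BdAB -scalemxAr linearZ /= -evmM.
rewrite expr2 invfM mulrA [w i * _]mulrC mulfK ?node_weight_neq0 //.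
congr (_ / _); rewrite /mxtrace rmorph_sum; apply: eq_bigr => j _.
by rewrite mxE.
Qed.

End Factorization.

(** Differentiating u1 A_F = A_G u0 shows that u1 intertwines the two projectors up to
a term A_G u0' B_F, which has trace zero against a1 since a1 A_G = A_F a0 and
BA = 0 at the nodes. *)
Lemma residue_trace_cyclic (F G : MF)
    (u0 : 'M[S]_(grank (mf0 G), grank (mf0 F))) (u1 : 'M[S]_(grank (mf1 G), grank (mf1 F)))
    (a0 : 'M[S]_(grank (mf0 F), grank (mf0 G))) (a1 : 'M[S]_(grank (mf1 F), grank (mf1 G))) :
    u1 *m A F = A G *m u0 -> u0 *m B F = B G *m u1 -> a1 *m A G = A F *m a0 ->
  residue_trace (a1 *m u1) = residue_trace (u1 *m a1).
Proof.
move=> uA uB aA; apply: eq_bigr => i _; congr (_ / _).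
have /(congr1 (mulmxr (evm i (B F)))) := congr1 (@dvm i _ _) uA.
rewrite !dvmM /= !mulmxDl -(mulmxA (dvm i u1)) evm_AB mulmx0 add0r => E.
have {}E : evm i u1 *m dvm i (A F) *m evm i (B F) =
    dvm i (A G) *m evm i (B G) *m evm i u1 + evm i (A G) *m dvm i u0 *m evm i (B F).
  rewrite E -mulmxA -[evm i u0 *m _]evmM uB evmM mulmxA.
  by [].
rewrite evmM -!mulmxA (mulmxA (evm i u1)) E mulmxDr linearD /=.
have -> : \tr (evm i a1 *m (evm i (A G) *m dvm i u0 *m evm i (B F))) = 0.
  rewrite !mulmxA -[_ *m evm i (A G)]evmM aA evmM mxtrace_mulC !mulmxA evm_BA.
  by rewrite !mul0mx linear0.
by rewrite addr0 evmM [LHS]mxtrace_mulC [LHS]mxtrace_mulC !mulmxA [LHS]mxtrace_mulC !mulmxA.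
Qed.

End Residues.

Arguments residue_trace {k n r} F W.

(** * Nondegeneracy of the residue trace *)

Lemma matrix_choice (T : Type) a b (P : 'I_a -> 'I_b -> T -> Prop) :
  (forall i j, exists p, P i j p) -> exists X : 'M[T]_(a, b), forall i j, P i j (X i j).
Proof.
move=> H; have [g Pg] := fin_all_exists (fun i => fin_all_exists (H i)).
by exists (\matrix_(i, j) g i j) => i j; rewrite mxE.
Qed.

Lemma mxtrace_mul_delta (T : comPzRingType) a b (X : 'M[T]_(a, b)) i j :
  \tr (X *m delta_mx j i) = X i j.
Proof.
rewrite /mxtrace (bigD1 i) //= [X in X + _]mxE (bigD1 j) //= mxE !eqxx mulr1.
rewrite !big1 ?addr0 // => [l /negPf li|l /negPf lj]; last by rewrite mxE lj mulr0.
by rewrite mxE big1 // => m _; rewrite mxE li andbF mulr0.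
Qed.

Section Nondegeneracy.
Variables (k : fieldType) (n : nat) (r : 'I_n.+1 -> k).
Hypothesis r_inj : injective r.
Local Notation S := {mpoly k[2]}.
Local Notation f := (line_product r).
Local Notation w := (node_weight r).
Local Notation MF := (gmf n.+1 f).
Local Notation A := (@d0 _ _ _).
Local Notation B := (@d1 _ _ _).
Local Notation evm := (evm r).
Local Notation dvm := (dvm r).

Lemma scale_f_inj a b (X Y : 'M[S]_(a, b)) : f *: X = f *: Y -> X = Y.
Proof.
move=> E; apply/matrixP => i j; move/matrixP/(_ i j): E; rewrite !mxE.
exact/mulfI/line_product_neq0.
Qed.

(** As f has simple zeros, vanishing at the nodes is divisibility by f. *)
Lemma ghom_divisible (M N : gfree) d (X : 'M[S]_(grank N, grank M)) :
    ghom M N d X -> (forall i, evm i X = 0) ->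
  exists Y, ghom M N (d - n.+1%:Z) Y /\ X = f *: Y.
Proof.
move=> /ghomP hX X0.
have [i j|Y hY] := @matrix_choice S _ _
    (fun i j p => in_degree (d - n.+1%:Z + gtwist i - gtwist j) p /\ X i j = f * p).
  have [l|p [hp Xp]] := vanishing_divisible r_inj (hX i j).
    by move/matrixP/(_ i j): (X0 l); rewrite !mxE.
  exists p; split=> //; rewrite (_ : _ - _ = d + gtwist i - gtwist j - n.+1%:Z) //.
  by rewrite -!addrA; congr (_ + _); rewrite addrC -!addrA.
exists Y; split; last by apply/matrixP => i j; rewrite mxE; have [] := hY i j.
by apply/ghomP => i j; have [] := hY i j.
Qed.

Section Pair.
Variables F G : MF.

(** Testing on the matrices h0 with a single nonzero entry p and using cyclicity of
the trace, the hypothesis says that each entry of B_F c B_G annihilates the forms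
p of the corresponding degree; [interpolation] applies entry by entry. *)
Lemma trace_dual_interpolation
    (c : 'I_n.+1 -> 'M[k]_(grank (mf1 F), grank (mf0 G))) :
    (forall h0, ghom (mf0 F) (mf1 G) (- n.+1%:Z) h0 ->
       \sum_i \tr (c i *m evm i (B G *m h0 *m B F)) = 0) ->
  exists E, ghom (mf1 G) (mf0 F) (n + n)%:Z E /\
    forall i, evm i E = w i *: (evm i (B F) *m c i *m evm i (B G)).
Proof.
move=> orth; pose D i := evm i (B F) *m c i *m evm i (B G).
have [b a|E hE] := @matrix_choice S (grank (mf0 F)) (grank (mf1 G))
    (fun b a p => in_degree ((n + n)%:Z + gtwist b - gtwist a) p /\
       forall i, ev (r i) p = w i * D i b a).
  pose e := - n.+1%:Z + gtwist a - gtwist b.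
  rewrite (_ : _ - _ = n%:Z - 1 - e); last by rewrite /e; lia.
  apply: (interpolation r_inj) => p hp.
  pose h0 := p *: delta_mx a b : 'M[S]_(grank (mf1 G), grank (mf0 F)).
  rewrite -[RHS](orth h0).
    apply: eq_bigr => i _.
    rewrite !evmM !mulmxA [in RHS]mxtrace_mulC !mulmxA -/(D i).
    rewrite evmZ evm_delta -scalemxAr linearZ /= mxtrace_mul_delta mulrC.
    by [].
  apply/ghomP => i j; rewrite !mxE; case: eqP => [->|_]; last first.
    by rewrite mulr0 in_degree0.
  by case: eqP => [->|_]; rewrite ?mulr1 ?mulr0 ?in_degree0.
exists E; split.
  by apply/ghomP => i j; have [] := hE i j.
by move=> i; apply/matrixP => b a; rewrite !mxE; have [_ ->] := hE b a; rewrite ?mxE.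
Qed.

Lemma ghomB (M N : gfree) d (X Y : 'M[S]_(grank N, grank M)) :
  ghom M N d X -> ghom M N d Y -> ghom M N d (X - Y).
Proof.
by move=> hX hY; rewrite addrC -scaleN1r -mpolyC1 -mpolyCN; apply: ghomDZ.
Qed.

Variables (p0 : 'M[S]_(grank (mf0 G), grank (mf0 F)))
          (p1 : 'M[S]_(grank (mf1 G), grank (mf1 F))).
Hypothesis pB : p0 *m B F = B G *m p1.
Hypothesis p1_hom : ghom (mf1 F) (mf1 G) 0 p1.

(** The homotopy component h1 is forced: it has to be B_G (p1 - h0 B_F) / f, and the
hypothesis is exactly what makes this division possible. *)
Lemma null_from_nodes (h0 : 'M[S]_(grank (mf1 G), grank (mf0 F))) :
    ghom (mf0 F) (mf1 G) (- n.+1%:Z) h0 ->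
    (forall i, evm i (B G *m p1) = evm i (B G *m h0 *m B F)) ->
  exists h1, [/\ ghom (mf1 F) (mf0 G) 0 h1,
    p0 = h1 *m A F + B G *m h0 & p1 = A G *m h1 + h0 *m B F].
Proof.
move=> hh0 ev_eq; pose X := B G *m p1 - B G *m h0 *m B F.
have hX : ghom (mf1 F) (mf0 G) n.+1%:Z X.
  apply: ghomB; first by rewrite -[n.+1%:Z]add0r; apply: ghomM p1_hom; apply: d1_graded.
  rewrite -mulmxA (_ : n.+1%:Z = n.+1%:Z - n.+1%:Z + n.+1%:Z); last by rewrite subrr add0r.
  by apply: ghomM; [|apply: ghomM hh0 _]; apply: d1_graded.
have [|h1 [hh1 Xh1]] := ghom_divisible hX.
  by move=> i; rewrite /X evmB ev_eq subrr.
rewrite subrr in hh1; exists h1; split=> //; apply: scale_f_inj.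
  rewrite scalerDr scalemxAl -Xh1 /X -pB mulmxBl -!mulmxA d1d0.
  by rewrite !mul_mx_scalar -scalemxAr subrK.
rewrite scalerDr scalemxAr -Xh1 /X mulmxBr !mulmxA d0d1 !mul_scalar_mx.
by rewrite -scalemxAl subrK.
Qed.

Hypothesis p_orth : forall w0 w1,
    ghom (mf0 G) (mf0 F) (n%:Z - 1) w0 -> ghom (mf1 G) (mf1 F) (n%:Z - 1) w1 ->
    w1 *m A G = A F *m w0 -> w0 *m B G = B F *m w1 ->
  residue_trace F (w1 *m p1) = 0.

(** The interpolating matrix E gives a morphism w = (E A_G / f, A_F E / f) from G to
the shift of F, and the value of the functional c on B_G p1 is the residue trace
of w composed with p, which vanishes by assumption. *)
Lemma test_functional_vanishes
    (c : 'I_n.+1 -> 'M[k]_(grank (mf1 F), grank (mf0 G))) :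
    (forall h0, ghom (mf0 F) (mf1 G) (- n.+1%:Z) h0 ->
       \sum_i \tr (c i *m evm i (B G *m h0 *m B F)) = 0) ->
  \sum_i \tr (c i *m evm i (B G *m p1)) = 0.
Proof.
move=> /trace_dual_interpolation[E [hE evE]].
have degE : (n + n)%:Z - n.+1%:Z = n%:Z - 1 by lia.
have [|i|w1 [hw1 w1E]] := @ghom_divisible (mf1 G) (mf1 F) (n + n)%:Z (A F *m E).
- by rewrite -[(n + n)%:Z]addr0; apply: ghomM hE; apply: d0_graded.
- by rewrite evmM evE -scalemxAr !mulmxA evm_AB !mul0mx scaler0.
have [|i|w0 [hw0 w0E]] := @ghom_divisible (mf0 G) (mf0 F) (n + n)%:Z (E *m A G).
- by rewrite -[(n + n)%:Z]add0r; apply: ghomM hE _; apply: d0_graded.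
- by rewrite evmM evE -scalemxAl -mulmxA evm_BA mulmx0 scaler0.
rewrite degE in hw0 hw1.
have w1B : B F *m w1 = E.
  by apply: scale_f_inj; rewrite scalemxAr -w1E mulmxA d1d0 mul_scalar_mx.
have w0B : w0 *m B G = E.
  by apply: scale_f_inj; rewrite scalemxAl -w0E -mulmxA d0d1 mul_mx_scalar.
have w1A : w1 *m A G = A F *m w0.
  by apply: scale_f_inj; rewrite scalemxAl -w1E scalemxAr -w0E mulmxA.
(* At a node, cyclicity and B_F w1 = E turn tr (w1 p1 A' B_F) into
   w tr (c (B_G p1) A' B_F); writing B_G p1 as p0 B_F produces the factor
   B_F A' B_F = w B_F, and the two weights cancel the denominator. *)
rewrite -[RHS](p_orth hw0 hw1 w1A) ?w0B ?w1B //; apply: eq_bigr => i _.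
rewrite [in RHS]mxtrace_mulC [evm i (w1 *m _)]evmM !mulmxA -evmM w1B evE.
rewrite -!scalemxAl linearZ /= -[_ *m evm i p1]mulmxA -evmM -pB evmM.
rewrite -!mulmxA [in RHS]mxtrace_mulC -!mulmxA [evm i (B F) *m (dvm _ _ *m _)]mulmxA.
rewrite evm_BdAB -!scalemxAr linearZ /= mulrA -expr2 mulrC mulKf //.
by rewrite expf_neq0 ?node_weight_neq0.
Qed.

(** By [null_from_nodes] it suffices to find h0 with B_G p1 = B_G h0 B_F at the nodes.
The values of the right-hand side form a subspace, membership in which is tested
on functionals c by [test_functional_vanishes]. *)
Theorem residue_nondegenerate : exists h0 h1,
  [/\ ghom (mf0 F) (mf1 G) (- n.+1%:Z) h0, ghom (mf1 F) (mf0 G) 0 h1,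
      p0 = h1 *m A F + B G *m h0 & p1 = A G *m h1 + h0 *m B F].
Proof.
pose J : finType := ('I_n.+1 * ('I_(grank (mf0 G)) * 'I_(grank (mf1 F))))%type.
pose flat (U : 'I_n.+1 -> 'M[k]_(grank (mf0 G), grank (mf1 F))) (j : J) :=
  U j.1 j.2.1 j.2.2.
pose P (y : J -> k) := exists h0, ghom (mf0 F) (mf1 G) (- n.+1%:Z) h0 /\
  y = flat (fun i => evm i (B G *m h0 *m B F)).
have flatE U z : \sum_j flat U j * z j =
    \sum_i \tr ((\matrix_(b, a) z (i, (a, b))) *m U i).
  transitivity (\sum_(j : J) U j.1 j.2.1 j.2.2 * z (j.1, (j.2.1, j.2.2))).
    by apply: eq_bigr => -[i [a b]].
  rewrite -(pair_bigA _ (fun i ab => U i ab.1 ab.2 * z (i, (ab.1, ab.2)))) /=.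
  apply: eq_bigr => i _.
  rewrite -(pair_bigA _ (fun a b => U i a b * z (i, (a, b)))) /= exchange_big /=.
  by apply: eq_bigr => b _; rewrite mxE; apply: eq_bigr => a _; rewrite mxE mulrC.
have [h0 [hh0 eh0]] : P (flat (fun i => evm i (B G *m p1))).
  apply: subspace_test.
  - exists 0; split; first exact: ghom0.
    by apply/funext => j; rewrite /flat mulmx0 mul0mx mxE mxE rmorph0.
  - move=> a _ _ [u [hu ->]] [v [hv ->]]; exists (a%:MP *: u + v).
    split; first exact: ghomDZ.
    apply/funext => j; rewrite /flat mulmxDr mulmxDl evmD -scalemxAr -scalemxAl evmZ.
    by rewrite [ev _ a%:MP]mevalC [RHS]mxE [X in _ = X + _]mxE.
  - move=> z Hz; rewrite flatE; apply: test_functional_vanishes => h0 hh0.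
    by rewrite -flatE; apply: Hz; exists h0.
have [|h1 [hh1 e0 e1]] := null_from_nodes hh0.
  move=> i; apply/matrixP => a b.
  by have := congr1 (fun y => y (i, (a, b))) eh0.
by exists h0, h1.
Qed.

End Pair.
End Nondegeneracy.

(** * Serre functors from traces *)

Section NaturalIsomorphisms.
Variable k : fieldType.
Implicit Types A B C : lincat k.

(** Both directions of the isomorphism are kept as data: extracting the inverses from
[nat_isomorphic] would take a choice function. *)
Definition nat_inverse A B (F G : linfunctor A B)
    (eta : forall X, hom (F X) (G X)) (theta : forall X, hom (G X) (F X)) : Prop :=
  [/\ forall X, comp (theta X) (eta X) = idm (F X),
      forall X, comp (eta X) (theta X) = idm (G X)
    & forall X Y (f : hom X Y), comp (eta Y) (fmap F f) = comp (fmap G f) (eta X)].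

Definition nat_equiv A B (F G : linfunctor A B) : Prop :=
  exists eta theta, @nat_inverse A B F G eta theta.

Lemma nat_inverse_sym A B (F G : linfunctor A B) eta theta :
  @nat_inverse A B F G eta theta -> nat_inverse theta eta.
Proof.
case=> te et nat; split=> // X Y f.
by rewrite -[LHS]compm1 -(et X) compA -(compA (theta Y)) -nat compA te comp1m.
Qed.

Lemma nat_equiv_sym A B (F G : linfunctor A B) : nat_equiv F G -> nat_equiv G F.
Proof. by case=> eta [theta /nat_inverse_sym ni]; exists theta, eta. Qed.

Lemma nat_equiv_trans A B (F G H : linfunctor A B) :
  nat_equiv F G -> nat_equiv G H -> nat_equiv F H.
Proof.
case=> [e [t [te et ne]]] [e' [t' [te' et' ne']]].
exists (fun X => comp (e' X) (e X)), (fun X => comp (t X) (t' X)).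
split=> [X|X|X Y f].
- by rewrite compA -[comp (comp _ _) (e' X)]compA te' compm1.
- by rewrite compA -[comp (comp _ _) (t X)]compA et compm1.
- by rewrite -compA ne compA ne' compA.
Qed.

Lemma nat_equiv_postcomp A B C (H : linfunctor B C) (F G : linfunctor A B) :
  nat_equiv F G -> nat_equiv (fcomp H F) (fcomp H G).
Proof.
case=> [e [t [te et ne]]].
exists (fun X => fmap H (e X)), (fun X => fmap H (t X)).
by split=> [X|X|X Y f] /=; rewrite -!fmap_comp ?te ?et ?fmap1 // ne.
Qed.

Lemma nat_equiv_precomp A B C (H : linfunctor A B) (F G : linfunctor B C) :
  nat_equiv F G -> nat_equiv (fcomp F H) (fcomp G H).
Proof.
case=> [e [t [te et ne]]].
by exists (fun X => e (H X)), (fun X => t (H X)); split=> [X|X|X Y f] /=.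
Qed.

Lemma nat_equiv_isomorphic A B (F G : linfunctor A B) :
  nat_equiv F G -> nat_isomorphic F G.
Proof.
by case=> [e [t [te et ne]]]; exists e; split=> // X; exists (t X); split.
Qed.

Lemma is_equivalence_transfer A B (F F' : linfunctor A B) (G : linfunctor B A) :
    nat_equiv (fcomp G F) (idfun_lin A) -> nat_equiv (fcomp F G) (idfun_lin B) ->
    nat_equiv F' F ->
  is_equivalence F'.
Proof.
move=> gf fg ff'; exists G; split; apply: nat_equiv_isomorphic.
  exact: nat_equiv_trans (nat_equiv_postcomp G ff') gf.
exact: nat_equiv_trans (nat_equiv_precomp G ff') fg.
Qed.

End NaturalIsomorphisms.

Section SerreTraces.
Variables (k : fieldType) (A : lincat k).
Implicit Types (S : linfunctor A A) (M N : A).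

Definition finitely_spanned (V : lmodType k) : Prop :=
  exists (m : nat) (e : 'I_m -> V), forall v, exists c : 'I_m -> k,
    v = \sum_i c i *: e i.

(** The functionals f |-> tr (w f) encode a natural pairing between Hom(M, N) and
Hom(N, S M): naturality of the pairing is cyclicity of the trace. *)
Definition is_serre_trace S (tr : forall M, hom M (S M) -> k) : Prop :=
  [/\ forall M a x y, tr M (a *: x + y) = a * tr M x + tr M y,
      forall M M' (u : hom M' M) (a : hom M (S M')),
        tr M' (comp a u) = tr M (comp (fmap S u) a),
      forall M N (f : hom M N), (forall w, tr M (comp w f) = 0) -> f = 0
    & forall M N (w : hom N (S M)), (forall f, tr M (comp w f) = 0) -> w = 0].

Lemma compm0 M N (P : A) (f : hom N P) : comp f (0 : hom M N) = 0.
Proof.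
have := comp_linearr f (-1) (0 : hom M N) 0.
by rewrite !scaleN1r !addNr.
Qed.

(** When S is full, nondegeneracy in one variable gives it in the other: cyclicity
exchanges the roles of the two factors. *)
Lemma serre_trace_full S tr :
    (forall M a x y, tr M (a *: x + y) = a * tr M x + tr M y) ->
    (forall M M' (u : hom M' M) (a : hom M (S M')),
        tr M' (comp a u) = tr M (comp (fmap S u) a)) ->
    (forall M N (f : hom M N), (forall w, tr M (comp w f) = 0) -> f = 0) ->
    (forall M N (g : hom (S M) (S N)), exists f, g = fmap S f) ->
  is_serre_trace tr.
Proof.
move=> lin cyc nondeg full; split=> // M N w w0.
by apply: nondeg => g; have [f ->] := full _ _ g; rewrite -cyc.
Qed.

Lemma serre_trace_transfer S S' tr : nat_equiv S S' ->
  @is_serre_trace S tr -> exists tr', @is_serre_trace S' tr'.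
Proof.
case=> [e [t ni]]; have [_ _ nt] := nat_inverse_sym ni; have [te et _] := ni.
case=> lin cyc nondegl nondegr.
exists (fun M a => tr M (comp (t M) a)); split.
- by move=> M a x y; rewrite comp_linearr lin.
- by move=> M M' u a; rewrite compA cyc !compA nt.
- move=> M N f f0; apply: nondegl => w.
  by have := f0 (comp (e M) w); rewrite !compA te comp1m.
- move=> M N w w0; rewrite -[w]comp1m -et -compA [comp (t M) w]nondegr ?compm0 //.
  by move=> f; rewrite -compA w0.
Qed.

Definition mk_dual (V : lmodType k) (l : V -> k)
    (lin : forall a x y, l (a *: x + y) = a * l x + l y) : dual V :=
  HB.pack (l : V -> k^o) (GRing.isLinear.Build k V k^o _ l lin).

Lemma dual_comb (V : lmodType k) (xi : dual V) m (e : 'I_m -> V) (c : 'I_m -> k) :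
  xi (\sum_i c i *: e i) = \sum_i c i * xi (e i) :> k.
Proof.
rewrite linear_sum; elim/big_ind2: _ => // [u x v y -> ->|i _] //.
by rewrite linearZ.
Qed.

(** Surjectivity onto the dual is the only point beyond nondegeneracy: a functional xi
on Hom(N, S M) is determined by its values on a finite spanning family, and
[subspace_test] finds f realizing these values, as any relation among the
tr (e_i f) holding for all f is a linear relation among the e_i. *)
Lemma serre_functor_of_trace S tr :
    (forall M N, finitely_spanned (hom M N)) -> is_equivalence S ->
    @is_serre_trace S tr ->
  is_serre_functor S.
Proof.
move=> fin eqS [lin cyc nondegl nondegr]; split=> //.
have linw M N (f : hom M N) a (w w' : hom N (S M)) :
    tr M (comp (a *: w + w') f) = a * tr M (comp w f) + tr M (comp w' f).
  by rewrite (comp_linearl f) lin.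
have linf M N (w : hom N (S M)) a (f f' : hom M N) :
    tr M (comp w (a *: f + f')) = a * tr M (comp w f) + tr M (comp w f').
  by rewrite (comp_linearr w) lin.
have tr0 M : tr M 0 = 0.
  by have := lin M (-1) 0 0; rewrite scaleN1r mulN1r !addNr.
pose Phi M N (f : hom M N) := mk_dual (linw M N f).
exists Phi; split; last first.
  by move=> M M' N N' u v f w; rewrite /= !compA cyc !compA.
move=> M N; split.
- by move=> a u v w; rewrite /= linf.
- move=> u v uv; apply/eqP; rewrite -subr_eq0; apply/eqP/nondegl => w.
  rewrite -scaleN1r addrC linf.
  by have := uv w => /= ->; rewrite mulN1r addNr.
move=> xi; have [m [e spe]] := fin N (S M).
have [f fE] : exists f : hom M N, (fun i => xi (e i)) = (fun i => tr M (comp (e i) f)).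
  apply: (@subspace_test _ _ (fun y => exists f : hom M N, y = fun i => tr M (comp (e i) f))).
  - by exists 0; apply/funext => i; rewrite compm0 tr0.
  - by move=> a _ _ [f ->] [g ->]; exists (a *: f + g); apply/funext => i; rewrite linf.
  move=> z zorth; pose w := \sum_i z i *: e i.
  have w0 : w = 0.
    apply: nondegr => f; have := zorth _ (ex_intro _ f erefl).
    have -> : tr M (comp w f) = Phi M N f w by [].
    by rewrite dual_comb => zo; rewrite -[RHS]zo; apply: eq_bigr => i _; rewrite mulrC.
  transitivity (xi w : k); last by rewrite w0 linear0.
  by rewrite dual_comb; apply: eq_bigr => i _; rewrite mulrC.
exists f => w; have [c ->] := spe w.
rewrite !dual_comb; apply: eq_bigr => i _; congr (_ * _).
by have := congr1 (@^~ i) fE => /= ->.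
Qed.

End SerreTraces.

(** * Finite-dimensionality of the Hom spaces *)

Section FiniteSpan.
Variables (k : fieldType) (h : nat) (f : {mpoly k[2]}).
Local Notation S := {mpoly k[2]}.
Local Notation MF := (gmf h f).

Lemma ghom_size_bound (M N : gfree) d : exists K, forall X : 'M[S]_(grank N, grank M),
  ghom M N d X -> forall i j, (size (deh (X i j)) <= K)%N.
Proof.
pose D i j := d + @gtwist N i - @gtwist M j.
exists (\max_i \max_j absz (D i j + 1)%R)%N => X /ghomP hX i j.
apply: leq_trans (leq_bigmax i); apply: leq_trans (leq_bigmax j).
case: (deh_size (hX i j)) => [->|]; first by rewrite size_poly0.
by rewrite -/(D i j) => sz; lia.
Qed.

(** Coefficients of the dehomogenized entries embed the morphisms in a
finite-dimensional space. *)
Lemma hmf_hom_finitely_spanned (F G : MF) : finitely_spanned (hmf_hom F G).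
Proof.
have [K0 b0] := ghom_size_bound (mf0 F) (mf0 G) 0.
have [K1 b1] := ghom_size_bound (mf1 F) (mf1 G) 0.
pose J : finType := ('I_(grank (mf0 G)) * 'I_(grank (mf0 F)) * 'I_K0 +
                     'I_(grank (mf1 G)) * 'I_(grank (mf1 F)) * 'I_K1)%type.
pose iota (p : mor F G) (j : J) : k := match j with
  | inl a => (deh ((mor_val p).1 a.1.1 a.1.2))`_a.2
  | inr a => (deh ((mor_val p).2 a.1.1 a.1.2))`_a.2 end.
have iota_lin a p q j : iota (a *: p + q) j = a * iota p j + iota q j.
  by case: j => [] [[i j] l] /=; rewrite !mxE mul_mpolyC rmorphD /= dehZ coefD coefZ.
have iota_inj p q : iota p =1 iota q -> p = q.
  move=> pq; have [p0 p1 _ _] := morP p; have [q0 q1 _ _] := morP q.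
  apply: mor_eq; apply/matrixP => i j.
    apply: (deh_inj ((ghomP _ _).1 p0 i j) ((ghomP _ _).1 q0 i j)).
    apply/polyP => l; have [lt|ge] := ltnP l K0.
      exact: (pq (inl (i, j, Ordinal lt))).
    by rewrite !nth_default // (leq_trans _ ge) ?b0.
  apply: (deh_inj ((ghomP _ _).1 p1 i j) ((ghomP _ _).1 q1 i j)).
  apply/polyP => l; have [lt|ge] := ltnP l K1.
    exact: (pq (inr (i, j, Ordinal lt))).
  by rewrite !nth_default // (leq_trans _ ge) ?b1.
have iota0 : iota 0 = fun=> 0.
  apply/funext => j; have := iota_lin (-1) 0 0 j.
  by rewrite scaleN1r mulN1r !addNr.
have [||m [e [Pe spe]]] := @subspace_span k J (fun y => exists p, y = iota p).
- by exists 0.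
- by move=> a _ _ [p ->] [q ->]; exists (a *: p + q); apply/funext => j; rewrite iota_lin.
have [g ge] := fin_all_exists Pe.
exists m, (fun i => hmf_class (g i)) => v; rewrite -[v]hmf_reprK.
have [c cE] := spe _ (ex_intro _ (hmf_repr v) erefl); exists c.
have iota_sum : forall s : seq 'I_m, iota (\sum_(i <- s) c i *: g i) =1
    (fun j => \sum_(i <- s) c i * e i j).
  elim=> [|i s IHs] j; first by rewrite !big_nil iota0.
  by rewrite !big_cons iota_lin IHs ge.
have -> : hmf_repr v = \sum_i c i *: g i.
  by apply: iota_inj => j; rewrite iota_sum -cE.
elim/big_rec2: _ => [|i x y _ <-]; last by rewrite hmf_class_linear.
have := @hmf_class_linear k h f F G (-1) 0 0.
by rewrite scaleN1r addNr scaleN1r addNr.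
Qed.

End FiniteSpan.

(** * Shifts by arbitrary integers *)

Section IntegerShifts.
Variables (k : fieldType) (h : nat) (f : {mpoly k[2]}).
Local Notation S := {mpoly k[2]}.
Local Notation MF := (gmf h f).

Definition gshiftz (a : int) (M : gfree) : gfree := GFree (fun i => @gtwist M i + a).

Lemma ghom_shiftz_codom a (M N : gfree) d (X : 'M[S]_(grank N, grank M)) :
  ghom M (gshiftz a N) d X <-> ghom M N (d + a) X.
Proof.
split=> /ghomP hX; apply/ghomP => i j; move: (hX i j) => /=;
by congr (is_true (in_degree _ _)); lia.
Qed.

Lemma ghom_shiftz_dom a (M N : gfree) d (X : 'M[S]_(grank N, grank M)) :
  ghom (gshiftz a M) N d X <-> ghom M N (d - a) X.
Proof.
split=> /ghomP hX; apply/ghomP => i j; move: (hX i j) => /=;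
by congr (is_true (in_degree _ _)); lia.
Qed.

Lemma ghom_shiftz a (M N : gfree) d (X : 'M[S]_(grank N, grank M)) :
  ghom (gshiftz a M) (gshiftz a N) d X <-> ghom M N d X.
Proof.
by rewrite -[X in ghom M N X](addrK a); split=> [/ghom_shiftz_dom|hX];
  [|apply/ghom_shiftz_dom]; [move/ghom_shiftz_codom|apply/ghom_shiftz_codom];
  rewrite addrAC.
Qed.

Definition mf_shiftz a (F : MF) : MF :=
  @GMF k h f (gshiftz a (mf0 F)) (gshiftz a (mf1 F)) (d0 F) (d1 F)
    (proj2 (@ghom_shiftz a (mf0 F) (mf1 F) _ _) (@d0_graded _ _ _ F))
    (proj2 (@ghom_shiftz a (mf1 F) (mf0 F) _ _) (@d1_graded _ _ _ F)) (d1d0 F) (d0d1 F).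

Lemma mor_shiftz_proof a F G (p : mor F G) :
  (mor_val p : premor (mf_shiftz a F) (mf_shiftz a G)) \in
    @mf_mor k h f (mf_shiftz a F) (mf_shiftz a G).
Proof.
have [p0 p1 pd0 pd1] := morP p; apply/asboolP; split=> //.
  exact/ghom_shiftz.
exact/ghom_shiftz.
Qed.
Definition mor_shiftz a F G (p : mor F G) : mor (mf_shiftz a F) (mf_shiftz a G) :=
  Mor (mor_shiftz_proof a p).

Lemma mor_unshiftz_proof a F G (p : mor (mf_shiftz a F) (mf_shiftz a G)) :
  (mor_val p : premor F G) \in @mf_mor k h f F G.
Proof.
have [p0 p1 pd0 pd1] := morP p; apply/asboolP; split=> //.
  exact/(ghom_shiftz a).
exact/(ghom_shiftz a).
Qed.

Lemma null_shiftz a F G (p : mor F G) : p \in @null_homotopic k h f F G ->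
  mor_shiftz a p \in @null_homotopic k h f (mf_shiftz a F) (mf_shiftz a G).
Proof.
move=> /asboolP[h0 [h1 [hh0 hh1 e0 e1]]]; apply/asboolP; exists h0, h1.
by split=> //; apply/ghom_shiftz.
Qed.

Definition hmf_shiftz a F G (x : hmf_hom F G) : hmf_hom (mf_shiftz a F) (mf_shiftz a G) :=
  hmf_class (mor_shiftz a (hmf_repr x)).

Lemma hmf_shiftzE a F G (p : mor F G) :
  hmf_shiftz a (hmf_class p) = hmf_class (mor_shiftz a p).
Proof.
have np : hmf_repr (hmf_class p) - p \in @null_homotopic k h f F G.
  by apply/hmf_class_eq; rewrite hmf_reprK.
apply/hmf_class_eq; move/(null_shiftz a): np.
by set u := mor_shiftz _ _; set v := (_ - _); have -> : u = v by apply: mor_eq.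
Qed.

Lemma hmf_shiftz1 a F : hmf_shiftz a (hmf_id F) = hmf_id (mf_shiftz a F).
Proof. by rewrite hmf_shiftzE; congr hmf_class; apply: mor_eq. Qed.
Lemma hmf_shiftz_comp a F G H (x : hmf_hom G H) (y : hmf_hom F G) :
  hmf_shiftz a (hmf_comp x y) = hmf_comp (hmf_shiftz a x) (hmf_shiftz a y).
Proof.
rewrite -[x]hmf_reprK -[y]hmf_reprK (hmf_compE (hmf_repr x)) !hmf_shiftzE hmf_compE.
by congr hmf_class; apply: mor_eq.
Qed.
Lemma hmf_shiftz_linear a F G : linear (@hmf_shiftz a F G).
Proof.
move=> c x y; rewrite -[x]hmf_reprK -[y]hmf_reprK -hmf_class_linear !hmf_shiftzE.
by rewrite -hmf_class_linear; congr hmf_class; apply: mor_eq.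
Qed.

Definition tauz a : linfunctor (HMF h f) (HMF h f) :=
  @LinFunctor k (HMF h f) (HMF h f) (mf_shiftz a) (@hmf_shiftz a) (hmf_shiftz1 a)
    (@hmf_shiftz_comp a) (@hmf_shiftz_linear a).

Lemma tauz_full a F G (g : hom (tauz a F) (tauz a G)) : exists x, g = fmap (tauz a) x.
Proof.
exists (hmf_class (Mor (mor_unshiftz_proof (hmf_repr g)))).
rewrite /= hmf_shiftzE -[LHS]hmf_reprK; congr hmf_class; exact: mor_eq.
Qed.

(** A functor that has the same matrices as Phi, but whose twists are given by other
functions with equal values, is isomorphic to Phi through identity matrices. The
twists a + 0, or a + b + c bracketed differently, are equal but not convertible,
which is why such an isomorphism is needed at all; the target functor is left in
constructor form so that its objects can be recognized by conversion. *)
Section Regrading.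
Variables (Phi : linfunctor (HMF h f) (HMF h f)).
Variables (c0 : forall F, 'I_(grank (mf0 (Phi F))) -> int).
Variables (c1 : forall F, 'I_(grank (mf1 (Phi F))) -> int).
Hypothesis c0E : forall F i, @gtwist (mf0 (Phi F)) i = @c0 F i.
Hypothesis c1E : forall F i, @gtwist (mf1 (Phi F)) i = @c1 F i.
Variable (g0 : forall F, ghom (GFree (@c0 F)) (GFree (@c1 F)) 0 (d0 (Phi F))).
Variable (g1 : forall F, ghom (GFree (@c1 F)) (GFree (@c0 F)) h (d1 (Phi F))).
Variable (e1 : forall F, d1 (Phi F) *m d0 (Phi F) = f%:M).
Variable (e0 : forall F, d0 (Phi F) *m d1 (Phi F) = f%:M).
Let regrade (F : HMF h f) : HMF h f := GMF (@g0 F) (@g1 F) (@e1 F) (@e0 F).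
Variable psi : forall F G : HMF h f, hom F G -> hom (regrade F) (regrade G).
Variable psi1 : forall F, psi (idm F) = idm (regrade F).
Variable psiC : forall F G H (x : hom G H) (y : hom F G),
  psi (comp x y) = comp (psi x) (psi y).
Variable psiL : forall F G, linear (@psi F G).
Hypothesis psiE : forall F G (x : hom F G), exists p (p' : mor (regrade F) (regrade G)),
  [/\ fmap Phi x = hmf_class p, psi x = hmf_class p' & mor_val p' = mor_val p].

Lemma regrade_nat_equiv : nat_equiv Phi (LinFunctor psi1 psiC psiL).
Proof.
have unit_hom (M : gfree) (c : 'I_(grank M) -> int) : @gtwist M =1 c ->
    @ghom k M (GFree c) 0 1%:M /\ @ghom k (GFree c) M 0 1%:M.
  move=> Mc; split; apply/ghomP => i j; rewrite mxE /=;
  by case: eqP => [->|_]; [rewrite Mc addrK; exact: dhomog1|exact: in_degree0].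
have eta_proof F : (mor_id_val (Phi F) : premor (Phi F) (regrade F)) \in
    @mf_mor k h f (Phi F) (regrade F).
  apply/asboolP; split=> /=; rewrite ?mul1mx ?mulmx1 //.
    by have [] := unit_hom _ _ (@c0E F).
  by have [] := unit_hom _ _ (@c1E F).
have theta_proof F : (mor_id_val (Phi F) : premor (regrade F) (Phi F)) \in
    @mf_mor k h f (regrade F) (Phi F).
  apply/asboolP; split=> /=; rewrite ?mul1mx ?mulmx1 //.
    by have [] := unit_hom _ _ (@c0E F).
  by have [] := unit_hom _ _ (@c1E F).
exists (fun F => hmf_class (Mor (eta_proof F))), (fun F => hmf_class (Mor (theta_proof F))).
split=> [F|F|F G x] /=.
- by rewrite hmf_compE; congr hmf_class; apply: mor_eq; rewrite /= mul1mx.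
- by rewrite hmf_compE; congr hmf_class; apply: mor_eq; rewrite /= mul1mx.
have [p [p' [-> -> pp']]] := psiE x.
rewrite !hmf_compE; congr hmf_class; apply: mor_eq; rewrite /= pp' mul1mx.
  by rewrite [RHS]mulmx1.
by rewrite [RHS]mulmx1.
Qed.

End Regrading.

Lemma idfun_tauz0 : nat_equiv (idfun_lin (HMF h f)) (tauz 0).
Proof.
apply: regrade_nat_equiv => [F i|F i|F G x] /=; rewrite ?addr0 //.
exists (hmf_repr x), (mor_shiftz 0 (hmf_repr x)).
by rewrite hmf_reprK.
Qed.

Lemma tau_tauz1 : nat_equiv (tau h f) (tauz 1).
Proof.
apply: regrade_nat_equiv => [F i|F i|F G x] //=.
by exists (mor_shift (hmf_repr x)), (mor_shiftz 1 (hmf_repr x)).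
Qed.

Lemma tauzD a b : nat_equiv (fcomp (tauz b) (tauz a)) (tauz (a + b)).
Proof.
apply: regrade_nat_equiv => [F i|F i|F G x] /=; rewrite ?addrA //.
exists (mor_shiftz b (mor_shiftz a (hmf_repr x))), (mor_shiftz (a + b) (hmf_repr x)).
by rewrite -hmf_shiftzE.
Qed.

(** The rank of an iterated shift reduces only for a concrete number of iterations,
so the iterates are compared with the integer shifts, whose ranks do not change
up to conversion. *)
Lemma fpow_tau m : nat_equiv (fpow (tau h f) m) (tauz m%:Z).
Proof.
elim: m => [|m IHm] /=; first exact: idfun_tauz0.
apply: nat_equiv_trans (nat_equiv_postcomp _ IHm) _.
apply: nat_equiv_trans (nat_equiv_precomp _ tau_tauz1) _.
by rewrite -addn1 PoszD; apply: tauzD.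
Qed.

Lemma fpow_tau_equivalence m : is_equivalence (fpow (tau h f) m).
Proof.
have inv a : nat_equiv (fcomp (tauz a) (tauz (- a))) (idfun_lin (HMF h f)).
  apply: nat_equiv_trans (tauzD _ _) _; rewrite addNr.
  exact/nat_equiv_sym/idfun_tauz0.
apply: (is_equivalence_transfer (G := tauz (- m%:Z))) (inv _) (fpow_tau m).
by have := inv (- m%:Z); rewrite opprK.
Qed.

End IntegerShifts.

(** * Serre duality for matrix factorizations *)

Section SerreTrace.
Variables (k : fieldType) (n : nat) (r : 'I_n.+1 -> k).
Hypothesis r_inj : injective r.
Local Notation S := {mpoly k[2]}.
Local Notation f := (line_product r).
Local Notation MF := (gmf n.+1 f).
Local Notation shift := (mf_shiftz (n%:Z - 1)).

Definition hmf_trace (F : MF) (x : hmf_hom F (shift F)) : k :=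
  residue_trace F (mor_val (hmf_repr x)).2.

(** In a null-homotopy from F to its shift by n - 1 the component h0 has degree
-(n + 1) + (n - 1) = -2 as a map between the original modules. *)
Lemma hmf_traceE F (p : mor F (shift F)) :
  hmf_trace (hmf_class p) = residue_trace F (mor_val p).2.
Proof.
have : hmf_repr (hmf_class p) - p \in @null_homotopic _ _ _ F (shift F).
  by apply/hmf_class_eq; rewrite hmf_reprK.
rewrite /hmf_trace; move: (hmf_repr _) => p'.
case/asboolP=> [h0 [h1 [/ghom_shiftz_codom hh0 _ _ e]]].
pose W' : 'M[S]_(grank (mf1 F)) := (mor_val p').2.
pose W : 'M[S]_(grank (mf1 F)) := (mor_val p).2.
have tr0 : residue_trace F (W' - W) = 0.
  rewrite (_ : W' - W = d0 F *m h1 + h0 *m d1 F) //.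
  apply: residue_trace_null => //.
  by rewrite (_ : - 2%:Z = - n.+1%:Z + (n%:Z - 1)); last by lia.
have := residue_traceDZ 1 (W' - W) W.
by rewrite mpolyC1 scale1r subrK tr0 mulr0 add0r.
Qed.

Theorem hmf_serre_trace : is_serre_trace (S := tauz n.+1 f (n%:Z - 1)) hmf_trace.
Proof.
apply: serre_trace_full.
- move=> F a x y; rewrite -[x]hmf_reprK -[y]hmf_reprK -hmf_class_linear !hmf_traceE.
  exact: residue_traceDZ.
- move=> F F' u a; rewrite -[u]hmf_reprK -[a]hmf_reprK /= hmf_shiftzE !hmf_compE.
  move: (hmf_repr u) (hmf_repr a) => {u a} u a; rewrite !hmf_traceE /=.
  have [_ _ uA uB] := morP u; have [_ _ aA _] := morP a.
  exact: residue_trace_cyclic uA uB aA.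
- move=> F G x x0; rewrite -[x]hmf_reprK.
  have -> : 0 = hmf_class (0 : mor F G).
    have := @hmf_class_linear _ n.+1 f F G (-1) 0 0.
    by rewrite scaleN1r addNr scaleN1r addNr.
  apply/hmf_class_eq; rewrite subr0; apply/asboolP.
  have [p0 p1 pA pB] := morP (hmf_repr x).
  apply: residue_nondegenerate => // w0 w1 hw0 hw1 wA wB.
  have wP : ((w0, w1) : premor G (shift F)) \in @mf_mor _ _ _ G (shift F).
    apply/asboolP; split=> //=.
      by apply/ghom_shiftz_codom; rewrite add0r.
    by apply/ghom_shiftz_codom; rewrite add0r.
  rewrite -[RHS](x0 (hmf_class (Mor wP))) -[x in RHS]hmf_reprK /= hmf_compE hmf_traceE.
  by [].
- exact: tauz_full.
Qed.

End SerreTrace.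

Theorem corollary4p12 (R : realType) (mu : nat) (hmu : (1 <= mu)%N)
    (t : 'I_mu -> R[i]) (ht : generic_parameter t) :
  is_serre_functor (fpow (tau mu.+1 (f_tilde t)) (mu - 1)%N).
Proof.
have [s [s0 ts s_inj]] := ht.
rewrite (f_tildeE s0 ts).
have r_inj : injective (fun i => - s i) by move=> i j /oppr_inj/s_inj.
pose f := line_product (fun i => - s i); rewrite -/f.
have : exists tr, is_serre_trace (S := tauz mu.+1 f (mu%:Z - 1)) tr.
  by exists (@hmf_trace _ mu (fun i => - s i)); apply: hmf_serre_trace r_inj.
rewrite subzn // => -[_ /(serre_trace_transfer (nat_equiv_sym (fpow_tau _ _ _)))[tr]].
apply: serre_functor_of_trace; last exact: fpow_tau_equivalence.
exact: hmf_hom_finitely_spanned.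
Qed.
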